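(* Let $(A,L)$ be an $LR_\infty[1]$ algebra, $Q$ a graded $A$-module, $\Delta$ a right $(A,L)$-connection in $Q$, and for $u_1,\dots,u_{k-1}\in S_A^\bullet L$, $U\in S_A^\bullet L\otimes_AQ$, $k\ge1$, put $$R_k^\Delta(u_1,\dots,u_{k-1}|U):=[\cdots[[D_k^\Delta,\mu_{u_1}],\mu_{u_2}]\cdots,\mu_{u_{k-1}}]\,U .$$ Then the sum $R^\Delta:=R_1^\Delta+R_2^\Delta+\cdots$ is a right $(K,S_A^\bullet L)$-connection in $S_A^\bullet L\otimes_AQ$, whose curvature $J(R^\Delta)$ is given by $$J(R^\Delta)(u_1,\dots,u_{k-1}|U)=[\cdots[[\mathcal J_k^\Delta,\mu_{u_1}],\mu_{u_2}]\cdots,\mu_{u_{k-1}}]\,U .$$ Moreover, $$R^\Delta(u_1,\dots,u_{k-1}|\mu_uU)=\mu_{\{u_1,\dots,u_{k-1},u\}}U+(-)^\chi\mu_uR^\Delta(u_1,\dots,u_{k-1}|U),$$ where $\chi=\bar u(\bar u_1+\cdots+\bar u_{k-1}+1)$, and $$R^\Delta(uu_1,u_2,\dots,u_{k-1}|U)=(-)^u\mu_uR^\Delta(u_1,\dots,u_{k-1}|U)+(-)^{\chi'}R^\Delta(u,u_2,\dots,u_{k-1}|\mu_{u_1}U),$$ where $\chi'=\bar u_1(\bar u_2+\cdots+\bar u_{k-1})$, for all symmetric tensors $u,u_1,\dots,u_{k-1}\in S_A^\bullet L$ and all $U\in S_A^\bullet L\otimes_AQ$.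
   Context: Conventions: $K$ is a field of characteristic $0$; graded means $\mathbb Z$-graded; $\bar v$ is the degree of a homogeneous element or map $v$, and bars are omitted in exponents of signs: $(-)^{v}=(-1)^{\bar v}$, $(-)^{vw}=(-1)^{\bar v\bar w}$. $[F,G]=F\circ G-(-)^{FG}G\circ F$ is the graded commutator. $S_{\ell,m}$ is the set of $(\ell,m)$-unshuffles, i.e. permutations $\pi$ of $\{1,\dots,\ell+m\}$ with $\pi(1)<\cdots<\pi(\ell)$ and $\pi(\ell+1)<\cdots<\pi(\ell+m)$ (sums over $S_{\ell,m}$ with $\ell<0$ or $m<0$ are zero). $\alpha(\pi,\boldsymbol v)$ is the Koszul sign: $v_{\pi(1)}\odot\cdots\odot v_{\pi(n)}=\alpha(\pi,\boldsymbol v)\,v_1\odot\cdots\odot v_n$ in the graded symmetric algebra. Multilinearity over a graded algebra and graded symmetry use the Koszul sign rule. $LR_\infty[1]$ algebra: let $A$ be an associative, graded commutative, unital $K$-algebra and $L$ a graded $A$-module. An $LR_\infty[1]$ algebra structure on $(A,L)$ is a degree $1$ multiderivation $\mathbb X=\mathbb X_1+\mathbb X_2+\cdots$ (formal infinite sum, no $0$-entry component), $\mathbb X_k=(X_k,\sigma_k)$, where $X_k:L^{\times k}\to L$ is graded symmetric, $K$-multilinear, of degree $1$, and $\sigma_k:L^{\times(k-1)}\to\mathrm{Der}A$ is graded symmetric, $A$-multilinear, of degree $1$ (write $\sigma_k(\xi_1,\dots,\xi_{k-1}|a)$ for $\sigma_k(\xi_1,\dots,\xi_{k-1})(a)$),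 with $$X_k(\xi_1,\dots,\xi_{k-1},a\xi_k)=\sigma_k(\xi_1,\dots,\xi_{k-1}|a)\,\xi_k+(-)^{(1+\xi_1+\cdots+\xi_{k-1})a}a\,X_k(\xi_1,\dots,\xi_k),$$ and such that for all $k$: (J1) $\sum_{i+j=k}\sum_{\pi\in S_{i,j}}\alpha(\pi,\boldsymbol\xi)X_{j+1}(X_i(\xi_{\pi(1)},\dots,\xi_{\pi(i)}),\xi_{\pi(i+1)},\dots,\xi_{\pi(i+j)})=0$, and (J2) $\sum_{i+j=k}\sum_{\pi\in S_{i,j-1}}\alpha(\pi,\boldsymbol\xi)\big[\sigma_{j+1}(X_i(\xi_{\pi(1)},\dots,\xi_{\pi(i)}),\xi_{\pi(i+1)},\dots,\xi_{\pi(k-1)}|a)+(-)^{\xi_{\pi(1)}+\cdots+\xi_{\pi(i)}}\sigma_{i+1}(\xi_{\pi(1)},\dots,\xi_{\pi(i)}|\sigma_j(\xi_{\pi(i+1)},\dots,\xi_{\pi(k-1)}|a))\big]=0$ (with $X_0=0$). Right connection: let $\mathrm{Der}^RQ$ be the set of pairs $(Z,\sigma_Z)$, with $Z:Q\to Q$ graded $K$-linear, $\sigma_Z\in\mathrm{Der}A$, $Z(aq)=(-)^{Za}aZ(q)+\sigma_Z(a)q$, with $A$-module structure $a\cdot(Z,\sigma_Z)=((-)^{aZ}Z\circ a,\,a\sigma_Z)$ ($a$ acting by multiplication). A right $(A,L)$-connection in $Q$ is $\Delta=\Delta_1+\Delta_2+\cdots$, with $\Delta_k:L^{\times(k-1)}\to\mathrm{Der}^RQ$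 graded symmetric, $A$-multilinear, of degree $1$, such that the symbol of $\Delta_k(\xi_1,\dots,\xi_{k-1})$ is $-\sigma_k(\xi_1,\dots,\xi_{k-1})$. Write $\Delta_k(\xi_1,\dots,\xi_{k-1}|q)$ for the value on $q$. Its curvature is $$J(\Delta)(\xi_1,\dots,\xi_{k-1}|q)=\sum_{i+j=k}\sum_{\pi\in S_{i,j-1}}\alpha(\pi,\boldsymbol\xi)\big[\Delta_{j+1}(X_i(\xi_{\pi(1)},\dots,\xi_{\pi(i)}),\xi_{\pi(i+1)},\dots,\xi_{\pi(k-1)}|q)-(-)^{\xi_{\pi(1)}+\cdots+\xi_{\pi(i)}}\Delta_{i+1}(\xi_{\pi(1)},\dots,\xi_{\pi(i)}|\Delta_j(\xi_{\pi(i+1)},\dots,\xi_{\pi(k-1)}|q))\big].$$ Tensors and operators: $S_A^\bullet L$ is the graded symmetric algebra of $L$ over $A$; its elements are called symmetric tensors; $\mu_u$ denotes left multiplication by $u\in S_A^\bullet L$ on $S_A^\bullet L\otimes_AQ$. $D_k^\Delta:S_A^\ell L\otimes_AQ\to S_A^{\ell-k+1}L\otimes_AQ$ is $$D_k^\Delta(\xi_1\cdots\xi_\ell\otimes q)=\sum_{\tau\in S_{k,\ell-k}}\alpha(\tau,\boldsymbol\xi)X_k(\xi_{\tau(1)},\dots,\xi_{\tau(k)})\xi_{\tau(k+1)}\cdots\xi_{\tau(\ell)}\otimes q-\sum_{\pi\in S_{\ell-k+1,k-1}}(-)^{\xi_{\pi(1)}+\cdots+\xi_{\pi(\ell-k+1)}}\alpha(\pi,\boldsymbol\xi)\xi_{\pi(1)}\cdots\xi_{\pi(\ell-k+1)}\otimes\Delta_k(\xi_{\pi(\ell-k+2)},\dots,\xi_{\pi(\ell)}|q).$$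 $D^\Delta=\sum_kD_k^\Delta$ and $\mathcal J^\Delta=\frac12[D^\Delta,D^\Delta]=\sum_k\mathcal J_k^\Delta$, with $\mathcal J_k^\Delta=\frac12\sum_{i+j=k+1}[D_i^\Delta,D_j^\Delta]$. The brackets $\{u_1,\dots,u_k\}:=\Lambda_k(u_1,\dots,u_k)$ on $S_A^\bullet L$: $\Lambda_k$ is the unique graded symmetric, $K$-multilinear, degree $1$ map $(S_A^\bullet L)^{\times k}\to S_A^\bullet L$ that is a graded derivation in each argument, with $\Lambda_k(\xi_1,\dots,\xi_k)=X_k(\xi_1,\dots,\xi_k)$, $\Lambda_k(\xi_1,\dots,\xi_{k-1},a)=\sigma_k(\xi_1,\dots,\xi_{k-1}|a)$ for $\xi_i\in L$, $a\in A$, and vanishing when at least two arguments are in $A$. With these brackets $(K,S_A^\bullet L)$ is an $LR_\infty[1]$ algebra (over $K$, with zero symbols); right $(K,S_A^\bullet L)$-connections and their curvature are understood accordingly (definitions above with $A,L,X_k,\sigma_k$ replaced by $K,S_A^\bullet L,\Lambda_k,0$).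
   Formalization: In the curvature J(R^Δ) the quadratic term R(..|R(..|U)) is taken with sign + instead of the printed −; with − the claim fails already for k=1, where it reads −D_1²U = D_1²U (take A=K, L=0, Δ_1²≠0). *)

(* Defs.v *)
From HB Require Import structures.
From mathcomp Require Import all_boot all_order all_algebra perm.
From mathcomp Require Import classical_sets fsbigop.

Set Implicit Arguments.
Unset Strict Implicit.
Unset Printing Implicit Defensive.

Import GRing.Theory.
Local Open Scope ring_scope.

(* A multilinear operation of variable arity, i.e. a formal sum             *)
(* f_1 + f_2 + ..., is one function f on lists; f_k is f on lists of size k *)
(* (size k - 1 when the last argument, written after the bar in             *)
(* sigma_k(x_1,..,x_(k-1) | a), is kept separate).                          *)

(* A Z-grading is given by its homogeneous components: [gcomp i v] is the   *)
(* component of degree i of v, and each v is the sum of finitely many.      *)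
Record gspace (K : fieldType) := GSpace {
  gs_sort :> lmodType K;
  gcomp : int -> gs_sort -> gs_sort;
  gcomp_linear : forall i, linear (gcomp i);
  gcompK : forall i j v, gcomp i (gcomp j v) = if i == j then gcomp j v else 0;
  gcomp_sum : forall v,
    exists2 s : seq int, uniq s & v = \sum_(i <- s) gcomp i v }.

Definition homog (K : fieldType) (V : gspace K) (i : int) (v : V) : Prop :=
  gcomp i v = v.

Definition homogs (K : fieldType) (V : gspace K) (ds : seq int) (vs : seq V) :=
  size ds = size vs /\ forall i, (i < size vs)%N -> homog ds`_i vs`_i.

Definition tdeg (ds : seq int) : int := \sum_(d <- ds) d.

(* Associative, unital, graded commutative algebras. *)
Record galg (K : fieldType) := GAlg {
  ga_alg :> algType K;
  ga_comp : int -> ga_alg -> ga_alg;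
  ga_linear : forall i, linear (ga_comp i);
  ga_compK : forall i j a,
    ga_comp i (ga_comp j a) = if i == j then ga_comp j a else 0;
  ga_sum : forall a, exists2 s : seq int, uniq s & a = \sum_(i <- s) ga_comp i a;
  ga_one : ga_comp 0 1 = 1;
  ga_mul : forall i j a b, ga_comp i a = a -> ga_comp j b = b ->
    ga_comp (i + j) (a * b) = a * b;
  ga_comm : forall i j a b, ga_comp i a = a -> ga_comp j b = b ->
    a * b = (-1) ^ (i * j) *: (b * a) }.

Definition ga_space (K : fieldType) (A : galg K) : gspace K :=
  GSpace (@ga_linear K A) (@ga_compK K A) (@ga_sum K A).
Coercion ga_space : galg >-> gspace.

Record gmod (K : fieldType) (A : galg K) := GMod {
  gm_space :> gspace K;
  mact : A -> gm_space -> gm_space;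
  mact_linear : forall a, linear (mact a);
  mactl_linear : forall x, linear (mact^~ x);
  mact_one : forall x, mact 1 x = x;
  mact_mul : forall a b x, mact (a * b) x = mact a (mact b x);
  mact_deg : forall i j (a : A) x,
    @homog K A i a -> homog j x -> homog (i + j) (mact a x) }.

(* The ground field as a graded algebra concentrated in degree 0, and any   *)
(* graded space as a graded module over it.                                 *)
Section GroundField.
Variable K : fieldType.

Definition base_comp (i : int) (k : K^o) : K^o := if i == 0 then k else 0.

Lemma base_linear i : linear (base_comp i).
Proof. by move=> c x y; rewrite /base_comp; case: eqP => // _; rewrite scaler0 addr0. Qed.

Lemma base_compK i j a :
  base_comp i (base_comp j a) = if i == j then base_comp j a else 0.
Proof.
rewrite /base_comp; have [<-|] := eqVneq i j; first by case: eqP.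
by have [->|//] := eqVneq i 0; rewrite eq_sym => /negPf ->.
Qed.

Lemma base_sum a :
  exists2 s : seq int, uniq s & a = \sum_(i <- s) base_comp i a.
Proof. by exists [:: 0] => //; rewrite big_seq1. Qed.

Lemma base_one : base_comp 0 1 = 1. Proof. by []. Qed.

Lemma base_homog i (a : K^o) : base_comp i a = a -> i != 0 -> a = 0.
Proof. by rewrite /base_comp; case: eqP. Qed.

Lemma base_mul i j (a b : K^o) : base_comp i a = a -> base_comp j b = b ->
  base_comp (i + j) (a * b) = a * b.
Proof.
move=> ha hb; rewrite /base_comp.
have [->|/(base_homog ha)->] := eqVneq i 0; last by rewrite mul0r if_same.
by have [->|/(base_homog hb)->] := eqVneq j 0; rewrite ?mulr0 ?if_same.
Qed.

Lemma base_comm i j (a b : K^o) : base_comp i a = a -> base_comp j b = b ->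
  a * b = (-1) ^ (i * j) *: (b * a).
Proof.
move=> ha hb.
have [->|/(base_homog ha)->] := eqVneq i 0; last by rewrite mul0r mulr0 scaler0.
by rewrite mul0r expr0z scale1r [LHS](@mulrC K).
Qed.

Definition base : galg K :=
  @GAlg K K^o base_comp base_linear base_compK base_sum base_one base_mul
    base_comm.

Variable V : gspace K.

Definition base_act (k : base) (v : V) : V := (k : K) *: v.

Lemma base_act_linear a : linear (base_act a).
Proof. by move=> c x y; rewrite /base_act scalerDr !scalerA mulrC. Qed.

Lemma base_actl_linear x : linear (base_act^~ x).
Proof. by move=> c a b; rewrite /base_act scalerDl scalerA. Qed.

Lemma base_act_one x : base_act 1 x = x. Proof. exact: scale1r. Qed.

Lemma base_act_mul a b x : base_act (a * b) x = base_act a (base_act b x).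
Proof. by rewrite /base_act scalerA. Qed.

Lemma base_act_deg i j (a : base) x :
  @homog K base i a -> homog j x -> homog (i + j) (base_act a x).
Proof.
rewrite /homog /base_act /= => ha hx.
have lin c : gcomp (i + j) (c *: x) = c *: gcomp (i + j) x.
  have z0 : gcomp (i + j) (0 : V) = 0.
    have := @gcomp_linear K V (i + j) (-1) 0 0.
    by rewrite !scaleN1r oppr0 addr0 addNr.
  by have := @gcomp_linear K V (i + j) c x 0; rewrite z0 !addr0.
rewrite lin; have [->|/(base_homog ha)->] := eqVneq i 0; first by rewrite add0r hx.
by rewrite !scale0r.
Qed.

Definition over_base : gmod base :=
  GMod base_act_linear base_actl_linear base_act_one base_act_mul base_act_deg.

End GroundField.

Definition is_galg_hom (K : fieldType) (A B : galg K) (f : A -> B) : Prop :=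
  [/\ linear f, f 1 = 1, forall a b, f (a * b) = f a * f b
    & forall i a, gcomp i (f a : ga_space B) = f (gcomp i (a : ga_space A))].

(* Degree 0 maps from an A-module to an A-algebra that are A-linear. *)
Definition is_gmod_hom_alg (K : fieldType) (A B : galg K) (L : gmod A)
    (jA : A -> B) (f : L -> B) : Prop :=
  [/\ linear f, forall a x, f (mact a x) = jA a * f x
    & forall i x, gcomp i (f x : ga_space B) = f (gcomp i x)].

Section Shuffles.
Variable n : nat.

(* S_(l,m) inside the permutations of n letters (empty unless l + m = n). *)
Definition unshuffles (l m : nat) : {set 'S_n} :=
  [set pi : 'S_n | (l + m == n)%N &&
    [forall i : 'I_n, forall j : 'I_n,
       ((i < j)%N && ((j < l)%N || (l <= i)%N)) ==> (pi i < pi j)%N]].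

Definition koszul (K : fieldType) (pi : 'S_n) (ds : seq int) : K :=
  \prod_(i < n) \prod_(j < n | (i < j)%N && (pi j < pi i)%N)
    (-1) ^ (ds`_(pi i) * ds`_(pi j)).

(* The list v_pi(1), ..., v_pi(n). *)
Definition permseq (V : zmodType) (pi : 'S_n) (vs : seq V) : seq V :=
  [seq vs`_(pi i) | i <- enum 'I_n].

End Shuffles.

Section Multi.
Variable K : fieldType.
Implicit Types V W : gspace K.

Definition multilinear V W (f : seq V -> W) : Prop :=
  forall s1 s2, linear (fun x => f (s1 ++ x :: s2)).

Definition gsymmetric V W (f : seq V -> W) : Prop :=
  forall ds vs, homogs ds vs -> forall pi : 'S_(size vs),
    f (permseq pi vs) = koszul K pi ds *: f vs.

Definition degree1 V W (f : seq V -> W) : Prop :=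
  forall ds vs, homogs ds vs -> homog (1 + tdeg ds) (f vs).

Definition linear_of_degree V W (p : int) (f : V -> W) : Prop :=
  linear f /\ forall i v, homog i v -> homog (p + i) (f v).

Definition gcommutator V (p q : int) (F G : V -> V) : V -> V :=
  fun v => F (G v) - (-1) ^ (p * q) *: G (F v).

End Multi.

Section Structures.
Variables (K : fieldType) (A : galg K).

(* Homogeneous elements of degree p of Der A. *)
Definition is_der (p : int) (s : A -> A) : Prop :=
  @linear_of_degree K A A p s /\
  forall i (a b : A), @homog K A i a ->
    s (a * b) = s a * b + (-1) ^ (p * i) *: (a * s b).

(* Homogeneous elements of degree p of Der^R Q. *)
Definition is_derR (Q : gmod A) (p : int) (Z : Q -> Q) (sZ : A -> A) : Prop :=
  [/\ linear_of_degree p Z, is_der p sZ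
    & forall i (a : A) q, @homog K A i a ->
        Z (mact a q) = (-1) ^ (p * i) *: mact a (Z q) + mact (sZ a) q].

Record is_LRinf (L : gmod A) (X : seq L -> L) (sg : seq L -> A -> A) : Prop := {
  lr_X0 : X [::] = 0;
  lr_Xlin : multilinear X;
  lr_Xsym : gsymmetric X;
  lr_Xdeg : degree1 X;
  lr_sglin : forall a, @multilinear K L A (sg^~ a);
  lr_sgsym : forall a, @gsymmetric K L A (sg^~ a);
  lr_sgder : forall ds xs, homogs ds xs -> is_der (1 + tdeg ds) (sg xs);
  lr_sgA : forall ds s1 x s2 i (a b : A), homogs ds s1 -> @homog K A i a ->
    sg (s1 ++ mact a x :: s2) b
    = (-1) ^ (i * (1 + tdeg ds)) *: (a * sg (s1 ++ x :: s2) b);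
  lr_XA : forall ds xs i (a : A) x, homogs ds xs -> @homog K A i a ->
    X (rcons xs (mact a x))
    = mact (sg xs a) x
      + (-1) ^ ((1 + tdeg ds) * i) *: mact a (X (rcons xs x));
  lr_J1 : forall ds xs, homogs ds xs -> let k := size xs in
    \sum_(i < k.+1) \sum_(pi in unshuffles k i (k - i))
      koszul K pi ds *:
        X (X (take i (permseq pi xs)) :: drop i (permseq pi xs)) = 0;
  lr_J2 : forall ds xs (a : A), homogs ds xs -> let n := size xs in
    \sum_(i < n.+1) \sum_(pi in unshuffles n i (n - i))
      koszul K pi ds *:
        (sg (X (take i (permseq pi xs)) :: drop i (permseq pi xs)) a
         + (-1) ^ tdeg (take i (permseq pi ds)) *:
             sg (take i (permseq pi xs)) (sg (drop i (permseq pi xs)) a)) = 0 }.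

(* In rc_A, the module structure of Der^R Q is                              *)
(* a . (Z, s) = ((-)^(aZ) Z o a, a s).                                      *)
Record right_connection (L Q : gmod A) (sg : seq L -> A -> A)
    (Dl : seq L -> Q -> Q) : Prop := {
  rc_lin : forall q, multilinear (Dl^~ q);
  rc_sym : forall q, gsymmetric (Dl^~ q);
  rc_der : forall ds xs, homogs ds xs ->
    is_derR (1 + tdeg ds) (Dl xs) (fun a => - sg xs a);
  rc_A : forall ds1 s1 j x ds2 s2 i (a : A) q,
    homogs ds1 s1 -> homog j x -> homogs ds2 s2 -> @homog K A i a ->
    Dl (s1 ++ mact a x :: s2) q
    = (-1) ^ (i * (1 + tdeg ds1)) *:
        ((-1) ^ (i * (1 + tdeg ds1 + j + tdeg ds2)) *:
           Dl (s1 ++ x :: s2) (mact a q)) }.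

End Structures.

(* Curvature of a connection Dl whose symbol is eps * sigma, eps = 1 or -1: *)
(* the relative sign making this expression tensorial is eps, by the        *)
(* Jacobi identity lr_J2 (eps = -1 for right connections with symbol        *)
(* - sigma).  When sigma = 0 the symbol does not determine eps; for         *)
(* connections built from operators with [Dl (xs), mu_u] = + mu_X(xs, u),   *)
(* such as Rop below, it is eps = 1.                                        *)
Definition curvature (K : fieldType) (L Q : gspace K) (eps : K)
    (X : seq L -> L) (Dl : seq L -> Q -> Q) (ds : seq int) (xs : seq L)
    (q : Q) : Q :=
  let n := size xs in
  \sum_(i < n.+1) \sum_(pi in unshuffles n i (n - i))
    koszul K pi ds *:
      (Dl (X (take i (permseq pi xs)) :: drop i (permseq pi xs)) q
       + (eps * (-1) ^ tdeg (take i (permseq pi ds))) *: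
           Dl (take i (permseq pi xs)) (Dl (drop i (permseq pi xs)) q)).

Section SymmetricTensors.
Variables (K : fieldType) (A : galg K) (L : gmod A).

(* (S, iA, iL) is the graded symmetric algebra of L over A. *)
Definition is_gsymalg (S : galg K) (iA : A -> S) (iL : L -> S) : Prop :=
  [/\ is_galg_hom iA, is_gmod_hom_alg iA iL
    & forall (B : galg K) (jA : A -> B) (jL : L -> B),
        is_galg_hom jA -> is_gmod_hom_alg jA jL ->
        exists! f : S -> B,
          [/\ is_galg_hom f, forall a, f (iA a) = jA a
            & forall x, f (iL x) = jL x]].

Variables (S : galg K) (iA : A -> S) (iL : L -> S).

(* The S-module T, with (s, q) |-> t s q, is the tensor product of S and Q  *)
(* over A; the right action of a on S is multiplication by iA a.            *)
Record is_tensor (Q : gmod A) (T : gmod S) (t : S -> Q -> T) : Prop := {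
  tens_linl : forall q, linear (t^~ q);
  tens_linr : forall s, linear (t s);
  tens_bal : forall s a q, t (s * iA a) q = t s (mact a q);
  tens_deg : forall i j (s : S) q, @homog K S i s -> homog j q ->
    homog (i + j) (t s q);
  tens_act : forall u s q, mact u (t s q) = t (u * s) q;
  tens_univ : forall (W : lmodType K) (f : S -> Q -> W),
    (forall q, linear (f^~ q)) -> (forall s, linear (f s)) ->
    (forall s a q, f (s * iA a) q = f s (mact a q)) ->
    exists! g : T -> W, linear g /\ forall s q, g (t s q) = f s q }.

Variables (X : seq L -> L) (sg : seq L -> A -> A).

Definition sprod (xs : seq L) : S := \prod_(x <- xs) iL x.

(* D k is the operator D_k^Dl.  If k > l (resp. k > l + 1) the subtraction  *)
(* in the first (resp. second) sum truncates, and that sum is empty.        *)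
Definition is_Dop (Q : gmod A) (Dl : seq L -> Q -> Q) (T : gmod S)
    (t : S -> Q -> T) (D : nat -> T -> T) : Prop :=
  forall k, (0 < k)%N -> linear (D k) /\
    forall ds xs q, homogs ds xs -> let l := size xs in
      D k (t (sprod xs) q)
      = \sum_(tau in unshuffles l k (l - k))
          koszul K tau ds *:
            t (iL (X (take k (permseq tau xs)))
               * sprod (drop k (permseq tau xs))) q
        - \sum_(pi in unshuffles l (l.+1 - k) k.-1)
            ((-1) ^ tdeg (take (l.+1 - k) (permseq pi ds)) * koszul K pi ds) *:
              t (sprod (take (l.+1 - k) (permseq pi xs)))
                (Dl (drop (l.+1 - k) (permseq pi xs)) q).

(* Lam (u_1, ..., u_k) is the bracket {u_1, ..., u_k}. *)
Record is_bracket (Lam : seq S -> S) : Prop := {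
  br_0 : Lam [::] = 0;
  br_lin : @multilinear K S S Lam;
  br_sym : @gsymmetric K S S Lam;
  br_deg : @degree1 K S S Lam;
  br_der : forall ds1 (s1 : seq S) ds2 (s2 : seq S) i j (u v : S),
    @homogs K S ds1 s1 -> @homogs K S ds2 s2 ->
    @homog K S i u -> @homog K S j v ->
    Lam (s1 ++ u * v :: s2)
    = (-1) ^ (j * tdeg ds2) *: (Lam (s1 ++ u :: s2) * v)
      + (-1) ^ ((1 + tdeg ds1) * i) *: (u * Lam (s1 ++ v :: s2));
  br_X : forall xs, (0 < size xs)%N -> Lam [seq iL x | x <- xs] = iL (X xs);
  br_sg : forall xs a, Lam (rcons [seq iL x | x <- xs] (iA a)) = iA (sg xs a);
  br_AA : forall s1 s2 s3 a b, Lam (s1 ++ iA a :: s2 ++ iA b :: s3) = 0 }.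

Variable T : gmod S.

(* [..[[F, mu_u1], mu_u2].., mu_um] for F of degree p; the graded commutator *)
(* with mu_u is extended linearly to non-homogeneous u.                     *)
Fixpoint iter_comm (p : int) (F : T -> T) (us : seq S) : T -> T :=
  if us is u :: us' then
    fun U => \sum_(d \in [set: int])
      (let ud : S := @gcomp K S d u in
       iter_comm (p + d) (gcommutator p d F (mact ud)) us' U)
  else F.

(* R^Dl, in arity k = size us + 1. *)
Definition Rop (D : nat -> T -> T) (us : seq S) (U : T) : T :=
  iter_comm 1 (D (size us).+1) us U.

Definition Jop (D : nat -> T -> T) (k : nat) (U : T) : T :=
  2%:R^-1 *: \sum_(1 <= i < k.+1) gcommutator 1 1 (D i) (D (k.+1 - i)%N) U.

End SymmetricTensors.

(* Main.v *)
(* The operators D_k have order at most k: commuting D_k with generators xi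
   of S(L) absorbs each xi as an argument of X_k or of Delta_k, and commuting
   with a in A leaves only the symbol of Delta_k.  Hence the k-fold commutator
   of D_k with generators is multiplication by their bracket Lambda_k; since
   iterated commutators with multiplications obey the same Leibniz rule as
   Lambda_k, this extends to all of S(L).  The Leibniz rules for R are then
   formal.  For the curvature, J_k is the sum of the D_i o D_(k+1-i), and the
   iterated commutator of a composite is the sum over unshuffles (I, J) of
   +-[D_i; u_I] o [D_(k+1-i); u_J].  Only the terms with |I| = i-2, i-1 or i
   survive: i-1 gives R(u_I | R(u_J | U)), and the other two together give
   R({u_I}, u_J | U). *)
From HB Require Import structures.
Require Import Defs.
From mathcomp Require Import all_boot all_order all_algebra perm.
From mathcomp Require Import boolp classical_sets fsbigop.
Set Implicit Arguments.
Unset Strict Implicit.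
Unset Printing Implicit Defensive.
Import GRing.Theory.
Local Open Scope ring_scope.

(** * Signs and Koszul sums over decompositions *)

(** The structures [S] and [T] are known only through universal properties, and [D k] is prescribed
    only on monomials tensored with an element of Q. Hence the span of [S] comes from a retraction,
    and equality of linear maps on [T] comes from uniqueness in the tensor property, a coefficient
    in A being absorbed into Q each time. Arguments are carried as pairs of a degree and an element,
    so that signs depend on the sequence alone. Sums over unshuffles are traded for a recursion over
    subsequences: commuting with one more element then matches one step of an induction. Once
    [D (size s)] commuted along [s] is known to be multiplication by the bracket, the rest forgets
    A, L and Q. The vanishing that cuts the curvature down is graded commutativity: multiplications
    commute, so one commutator more gives zero. Characteristic 0 serves to divide by 2 in the
    definition of the operator J_k. *)

Section Linear.
Variables (K : fieldType) (V W : lmodType K) (f : V -> W).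
Hypothesis f_lin : linear f.

Lemma lin0 : f 0 = 0.
Proof. by have := f_lin (-1) 0 0; rewrite scaler0 add0r scaleN1r addNr. Qed.

Lemma linD x y : f (x + y) = f x + f y.
Proof. by have := f_lin 1 x y; rewrite !scale1r. Qed.

Lemma linZ c x : f (c *: x) = c *: f x.
Proof. by have := f_lin c x 0; rewrite lin0 !addr0. Qed.

Lemma linN x : f (- x) = - f x.
Proof. by rewrite -scaleN1r linZ scaleN1r. Qed.

Lemma linB x y : f (x - y) = f x - f y.
Proof. by rewrite linD linN. Qed.

Lemma lin_sum I (r : seq I) (P : pred I) F :
  f (\sum_(i <- r | P i) F i) = \sum_(i <- r | P i) f (F i).
Proof. exact: (big_morph f linD lin0). Qed.

End Linear.

Section Signs.
Variable K : fieldType.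

Definition oddz (d : int) : bool := odd `|d|%N.

Lemma oddzD a b : oddz (a + b) = oddz a (+) oddz b.
Proof.
rewrite /oddz; case: a b => [a|a] [b|b].
- by rewrite -PoszD !absz_nat oddD.
- rewrite NegzE abszN !absz_nat; case: (leqP b.+1 a) => h.
    by rewrite subzn // absz_nat oddB.
  by rewrite -opprB subzn 1?ltnW // abszN absz_nat oddB 1?ltnW // addbC.
- rewrite NegzE addrC abszN !absz_nat; case: (leqP a.+1 b) => h.
    by rewrite subzn // absz_nat oddB // addbC.
  by rewrite -opprB subzn 1?ltnW // abszN absz_nat oddB 1?ltnW.
- by rewrite !NegzE -opprD !abszN -PoszD !absz_nat oddD.
Qed.

Lemma oddzM a b : oddz (a * b) = oddz a && oddz b.
Proof. by rewrite /oddz abszM oddM. Qed.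

Lemma oddzN a : oddz (- a) = oddz a.
Proof. by rewrite /oddz abszN. Qed.

Lemma oddz0 : oddz 0 = false. Proof. by []. Qed.
Lemma oddz1 : oddz 1 = true. Proof. by []. Qed.
Lemma oddz2 : oddz 2 = false. Proof. by []. Qed.

Definition oddzE := (oddzD, oddzM, oddzN, oddz0, oddz1, oddz2).

Lemma expN1z (d : int) : (-1) ^ d = (-1) ^+ oddz d :> K.
Proof.
case: d => n; first by rewrite /oddz /= signr_odd.
by rewrite NegzE -exprz_inv invrN invr1 oddzN /oddz absz_nat signr_odd.
Qed.

End Signs.

(* A sign (-1) ^ d depends only on the parity of d, a polynomial in the
   parities of the degrees, so it is enough to run through their values. *)
Ltac sgn_atoms :=
  repeat match goal with |- context [oddz ?d] => case: (oddz d) end.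
Ltac sgn := rewrite ?expN1z ?oddzE; sgn_atoms;
  rewrite /= ?expr1 ?expr0 ?mulrN ?mulNr ?mulr1 ?mul1r ?opprK //.

Section Splits.
Variables (K : fieldType) (V : zmodType).
Implicit Types (s I J : seq (int * V)) (W : lmodType K).

Definition sdeg s : int := tdeg (unzip1 s).

Lemma sdeg_nil : sdeg [::] = 0.
Proof. by rewrite /sdeg /tdeg big_nil. Qed.

Lemma sdeg_cons z s : sdeg (z :: s) = z.1 + sdeg s.
Proof. by rewrite /sdeg /tdeg big_cons. Qed.

Lemma sdeg_cat s1 s2 : sdeg (s1 ++ s2) = sdeg s1 + sdeg s2.
Proof. by rewrite /sdeg /tdeg /unzip1 map_cat big_cat. Qed.

Lemma sdeg_rcons s z : sdeg (rcons s z) = sdeg s + z.1.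
Proof. by rewrite -cats1 sdeg_cat sdeg_cons sdeg_nil addr0. Qed.

(* The sum of +-G I J over all decompositions of s into complementary
   subsequences I and J, with the Koszul sign of s |-> I ++ J. *)
Fixpoint ssum W s (G : seq (int * V) -> seq (int * V) -> W) : W :=
  if s is z :: s' then
    ssum s' (fun I J => G (z :: I) J)
    + ssum s' (fun I J => (-1) ^ (z.1 * sdeg I) *: G I (z :: J))
  else G [::] [::].

(** The summands need to agree only on decompositions that really occur; this is how homogeneity,
    sizes and degrees become available under the sum. *)
Lemma ssum_ext (P : pred (int * V)) W s (G G' : _ -> _ -> W) : all P s ->
  (forall I J, all P I -> all P J -> (size I + size J = size s)%N ->
     sdeg I + sdeg J = sdeg s -> G I J = G' I J) ->
  ssum s G = ssum s G'.
Proof.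
elim: s G G' => [|z s IHs] G G' /=; first by move=> _ ->; rewrite ?sdeg_nil.
case/andP=> Pz Ps GG'; congr (_ + _); apply: IHs => // I J PI PJ sz dg.
  by apply: GG' => //=; rewrite ?Pz ?addSn ?sz // !sdeg_cons -dg addrA.
congr (_ *: _); apply: GG' => //=; rewrite ?Pz ?addnS ?sz // !sdeg_cons -dg.
by rewrite addrCA.
Qed.

Lemma eq_ssum W s (G G' : _ -> _ -> W) :
  (forall I J, G I J = G' I J) -> ssum s G = ssum s G'.
Proof.
by move=> GG'; apply: (@ssum_ext predT) => [|I J *]; rewrite ?all_predT ?GG'.
Qed.

Lemma ssum_linear W W' (f : W -> W') s G : linear f ->
  f (ssum s G) = ssum s (fun I J => f (G I J)).
Proof.
move=> f_lin.
elim: s G => [|z s IHs] G //=; rewrite (linD f_lin) !IHs; congr (_ + _).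
by apply: eq_ssum => I J; rewrite (linZ f_lin).
Qed.

Lemma ssumD W s (G G' : _ -> _ -> W) :
  ssum s (fun I J => G I J + G' I J) = ssum s G + ssum s G'.
Proof.
elim: s G G' => [|z s IHs] G G' //=; rewrite IHs addrACA -IHs; congr (_ + _).
by rewrite -IHs; apply: eq_ssum => I J; rewrite scalerDr.
Qed.

Lemma ssumZ W c s (G : _ -> _ -> W) :
  ssum s (fun I J => c *: G I J) = c *: ssum s G.
Proof.
by rewrite (@ssum_linear _ _ ( *:%R c)) // => a x y;
  rewrite scalerDr !scalerA mulrC.
Qed.

Lemma ssumN W s (G : _ -> _ -> W) :
  ssum s (fun I J => - G I J) = - ssum s G.
Proof.
by rewrite -scaleN1r -ssumZ; apply: eq_ssum => I J; rewrite scaleN1r.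
Qed.

Lemma ssum0 W s : ssum s (fun _ _ => 0 : W) = 0.
Proof. by have := @ssumZ W 0 s (fun _ _ => 0); rewrite scaler0 scale0r. Qed.

Lemma ssum_sum W (n : nat) s (G : nat -> _ -> _ -> W) :
  \sum_(i < n) ssum s (G i) = ssum s (fun I J => \sum_(i < n) G i I J).
Proof.
elim: n => [|n IHn].
  by rewrite big_ord0 (@eq_ssum _ _ _ (fun _ _ => 0)) ?ssum0 // => *;
    rewrite big_ord0.
rewrite big_ord_recr /= IHn -ssumD; apply: eq_ssum => I J.
by rewrite big_ord_recr.
Qed.

(** Exchanging I and J exchanges the two branches of the recursion; the sign compares the orders I
    ++ J and J ++ I. *)
Lemma ssum_swap W s (G : _ -> _ -> W) :
  ssum s G = ssum s (fun I J => (-1) ^ (sdeg I * sdeg J) *: G J I).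
Proof.
elim: s G => [|z s IHs] G /=; first by rewrite sdeg_nil mul0r expr0z scale1r.
rewrite [in RHS]addrC; congr (_ + _); rewrite IHs; apply: eq_ssum => I J;
  rewrite ?scalerA sdeg_cons; congr (_ *: _); sgn.
Qed.

Lemma ssum_nil W s (G : _ -> _ -> W) :
  ssum s (fun I J => if size I == 0%N then G I J else 0) = G [::] s.
Proof.
elim: s G => [|z s IHs] G //=; rewrite ssum0 add0r -(IHs (fun I J =>
  G I (z :: J))).
apply: eq_ssum => [[|y I]] J /=; last exact: scaler0.
by rewrite sdeg_nil mulr0 expr0z scale1r.
Qed.

End Splits.

(** * Unshuffles *)

Section Permseq.
Variables (K : fieldType) (V : zmodType).

Lemma size_permseq n (pi : 'S_n) (s : seq V) : size (permseq pi s) = n.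
Proof. by rewrite size_map size_enum_ord. Qed.

Lemma nth_permseq n (pi : 'S_n) (s : seq V) (i : 'I_n) :
  (permseq pi s)`_i = s`_(pi i).
Proof.
by rewrite /permseq (nth_map i) ?size_enum_ord // nth_ord_enum.
Qed.

(** Every permutation is determined by the position j of the first letter and by the order of the
    others; all inductions on permutations below follow this description. *)
Lemma permseq_lift n (j : 'I_n.+1) (pi : 'S_n) z (s : seq V) :
  permseq (lift_perm j ord0 pi) (z :: s)
  = take j (permseq pi s) ++ z :: drop j (permseq pi s).
Proof.
have sz_take : size (take j (permseq pi s)) = j.
  by rewrite size_takel // size_permseq -ltnS.
apply: (@eq_from_nth _ 0) => [|i].
  rewrite size_cat /= size_drop sz_take !size_permseq addnS subnKC //.
  by rewrite -ltnS.
rewrite size_permseq => lt_i; rewrite -[i]/(val (Ordinal lt_i)) nth_permseq.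
case: (unliftP j (Ordinal lt_i)) => [k|] -> /=; last first.
  by rewrite lift_perm_id nth_cat sz_take ltnn subnn.
rewrite lift_perm_lift nth_cat sz_take /= /bump /=.
case: (leqP j k) => [le_jk|lt_kj]; rewrite ?add1n ?add0n /=; last first.
  by rewrite lt_kj nth_take // nth_permseq.
by rewrite ltnNge (leqW le_jk) /= subSn //= nth_drop subnKC // nth_permseq.
Qed.

Lemma permseq1 (s : seq V) n : size s = n -> permseq (1 : 'S_n) s = s.
Proof.
move=> sz; apply: (@eq_from_nth _ 0); rewrite size_permseq // => i lt_i.
by rewrite -[i]/(val (Ordinal lt_i)) nth_permseq perm1.
Qed.

End Permseq.

Lemma map_permseq (V V' : zmodType) (f : V -> V') n (pi : 'S_n) (s : seq V) :
  size s = n -> map f (permseq pi s) = permseq pi (map f s).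
Proof.
move=> sz; apply: (@eq_from_nth _ 0);
  rewrite size_map !size_permseq // => i lt_i.
rewrite (nth_map 0) ?size_permseq // -[i]/(val (Ordinal lt_i)) !nth_permseq.
by rewrite (nth_map 0) ?sz.
Qed.

Section Koszul.
Variables (K : fieldType).

Lemma tdeg_take n (ds : seq int) :
  tdeg (take n ds) = \sum_(i < size ds | (i < n)%N) ds`_i.
Proof.
elim: ds n => [|d ds IHds] n /=; first by rewrite /tdeg big_nil big_ord0.
case: n => [|n]; first by rewrite /tdeg big_nil big_pred0.
by rewrite /tdeg /= big_cons [X in _ + X]IHds big_mkcond [RHS]big_mkcond /=
  big_ord_recl.
Qed.

(** The first letter is inverted exactly with the letters placed before it, the first j entries of
    the permuted rest. *)
Lemma koszul_lift n (j : 'I_n.+1) (pi : 'S_n) d (ds : seq int) :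
  koszul K (lift_perm j ord0 pi) (d :: ds)
  = (-1) ^ (d * tdeg (take j (permseq pi ds))) * koszul K pi ds.
Proof.
rewrite /koszul (bigD1_ord j) //= [X in X * _]big_pred0 ?mul1r; last first.
  by move=> i; rewrite lift_perm_id andbF.
rewrite tdeg_take size_permseq big_distrr /=.
rewrite (big_morph (fun i => (-1) ^ i) (id1 := 1) (op1 := *%R)) //; last first.
  by move=> x y; sgn.
rewrite [in RHS]big_mkcond -big_split /=; apply: eq_bigr => k _.
rewrite big_mkcond (bigD1_ord j) //=; congr (_ * _).
  rewrite !lift_perm_lift lift_perm_id /= nth_permseq /bump /=.
  case: (leqP j k) => [le_jk|lt_kj].
    by rewrite add1n ltnNge (leqW le_jk).
  by rewrite !add0n lt_kj add1n /= mulrC.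
rewrite [RHS]big_mkcond /=; apply: eq_bigr => i _.
by rewrite !lift_perm_lift /= ltnNge leq_bump2 -ltnNge ltnS.
Qed.

Lemma koszul1 n (ds : seq int) : koszul K (1 : 'S_n) ds = 1.
Proof.
rewrite /koszul big1 // => i _; rewrite big_pred0 // => j; rewrite !perm1.
by case: ltngtP.
Qed.

(** Injectivity suffices, because both sides have (n+1)! elements. *)
Lemma lift_perm_bij n :
  bijective (fun p : 'I_n.+1 * 'S_n => lift_perm p.1 ord0 p.2).
Proof.
apply: inj_card_bij; last by rewrite card_prod !card_Sn card_ord factS.
move=> [j pi] [j' pi'] /= eq_pi.
have eq_j : j = j'.
  by apply: (@perm_inj _ (lift_perm j ord0 pi)); rewrite {2}eq_pi !lift_perm_id.
rewrite -{}eq_j in eq_pi *; congr (_, _); apply/permP => k.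
by apply: (@lift_inj _ ord0); rewrite -!(lift_perm_lift j) eq_pi.
Qed.

Lemma big_lift_perm (W : zmodType) n (P : pred 'S_n.+1) (F : 'S_n.+1 -> W) :
  \sum_(pi | P pi) F pi
  = \sum_(j < n.+1) \sum_(pi : 'S_n | P (lift_perm j ord0 pi))
      F (lift_perm j ord0 pi).
Proof.
rewrite pair_big_dep /=.
rewrite (reindex (fun p : 'I_n.+1 * 'S_n => lift_perm p.1 ord0 p.2)) //=.
exact/onW_bij/lift_perm_bij.
Qed.

Lemma unshufflesP n l m (pi : 'S_n) :
  reflect ((l + m)%N = n /\ forall i j : 'I_n, (i < j)%N ->
             ((j < l) || (l <= i))%N -> (pi i < pi j)%N)
          (pi \in unshuffles n l m).
Proof.
rewrite inE; apply: (iffP andP) => [[/eqP lm /forallP H]|[-> H]]; split=> //.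
  by move=> i j ij jl; have /forallP/(_ j) := H i; rewrite ij jl.
by apply/forallP => i; apply/forallP => j; apply/implyP => /andP[]; apply: H.
Qed.

Lemma unshuffles_lift0 n l m (pi : 'S_n) :
  (lift_perm ord0 ord0 pi \in unshuffles n.+1 l.+1 m)
    = (pi \in unshuffles n l m).
Proof.
apply/unshufflesP/unshufflesP=> [[[lm] H]|[lm H]]; split; rewrite ?addSn ?lm //.
  move=> i j ij jl; have := H (lift ord0 i) (lift ord0 j).
  by rewrite !lift_perm_lift /= !ltnS; apply.
move=> i j; case: (unliftP ord0 j) => [j'|] -> //.
rewrite lift_perm_lift; case: (unliftP ord0 i) => [i'|] ->.
  by rewrite lift_perm_lift /= !ltnS; apply: H.
by rewrite lift_perm_id.
Qed.

Lemma unshuffles_lift_mid n l m (pi : 'S_n) (j : 'I_n.+1) : j = l :> nat ->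
  (lift_perm j ord0 pi \in unshuffles n.+1 l m.+1) = (pi \in unshuffles n l m).
Proof.
move=> jl.
apply/unshufflesP/unshufflesP=> [[lm H]|[lm H]]; split; rewrite ?addnS ?lm //.
- by move: lm; rewrite addnS => -[].
- move=> i k ik kl; have := H (lift j i) (lift j k).
  rewrite !lift_perm_lift /= -jl ltnS; apply;
    first by rewrite ltnNge leq_bump2 -ltnNge.
  move: kl; rewrite -jl /bump; case/orP => h;
    first by rewrite (leqNgt j k) h add0n h.
  by rewrite h add1n (leqW h) orbT.
move=> i k; case: (unliftP j k) => [k'|] -> /=; last first.
  by rewrite jl ltnn /= => h1 h2; move: h1; rewrite ltnNge h2.
rewrite lift_perm_lift; case: (unliftP j i) => [i'|] -> /=; last first.
  by rewrite lift_perm_id.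
rewrite lift_perm_lift /= ltnS => ik h; apply: H.
  by move: ik; rewrite !ltnNge leq_bump2.
move: h; rewrite -jl /bump; case/orP.
  case: (leqP j k') => h; rewrite ?add1n //.
  by rewrite ltnNge (leqW h).
case: (leqP j i') => h; rewrite ?orbT //= add0n.
by move=> h'; move: h; rewrite ltnNge h'.
Qed.

(** The smallest letter must open the block that contains it, hence stands at position 0 or at
    position l. *)
Lemma unshuffles_liftN n l m (pi : 'S_n) (j : 'I_n.+1) :
  lift_perm j ord0 pi \in unshuffles n.+1 l m ->
  (j == 0 :> nat) && (0 < l)%N || (j == l :> nat) && (0 < m)%N.
Proof.
case/unshufflesP => lm H.
have {H} H i : (i < j)%N -> ~~ ((j < l) || (l <= i))%N.
  move=> ij; apply/negP => h.
  have lt_i : (i < n.+1)%N by apply: ltn_trans ij (ltn_ord j).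
  by have := H (Ordinal lt_i) j ij h; rewrite lift_perm_id.
case: l lm H => [|l] lm H.
  rewrite andbF; have m0 : (0 < m)%N by move: lm; rewrite add0n => ->.
  by rewrite m0 andbT /=; case: posnP => [//|/(H 0%N)]; rewrite orbT.
rewrite andbT; case: (posnP j) => //= j0; have := H 0%N j0;
  rewrite orbF -leqNgt => lj.
have := H j.-1; rewrite prednK // => /(_ (leqnn _)); rewrite negb_or -ltnNge.
case/andP=> _; rewrite -leqNgt -ltnS prednK // => jl.
have {}jl : j = l.+1 :> nat by apply/eqP; rewrite eqn_leq jl lj.
rewrite jl eqxx; move: lm (ltn_ord j); rewrite jl; case: m {H} => //.
by rewrite addn0 => ->; rewrite ltnn.
Qed.

(** The bridge from permutations to the recursion: the first entry of s stands at position 0 or l,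
    and these two cases are the two branches of [ssum]. *)
Lemma sum_unshuffles (V : zmodType) (W : lmodType K) n l m
    (s : seq (int * V)) (G : seq (int * V) -> seq (int * V) -> W) :
  size s = n -> (l + m)%N = n ->
  \sum_(pi in unshuffles n l m)
     koszul K pi (unzip1 s) *: G (take l (permseq pi s)) (drop l (permseq pi s))
  = ssum s (fun I J => if size I == l then G I J else 0).
Proof.
elim: n l m s G => [|n IHn] l m s G.
  case: s => //= _; case: l m => [|l] [|m] //= _.
  rewrite (bigD1 (1%g : 'S_0)) /=; last by apply/unshufflesP; split=> // -[].
  rewrite koszul1 scale1r permseq1 //= big1 ?addr0 // => pi /andP[_ /eqP[]].
  by apply/permP => -[].
case: s => //= z s [sz] lm; rewrite big_lift_perm /=.
(* [E1] and [E2] collect the permutations with the first entry at position 0 and l. For l = 0 the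
   positions coincide, and the guards make only [E2] count. *)
pose E1 := if (0 < l)%N then \sum_(pi in unshuffles n l.-1 m)
   koszul K pi (unzip1 s) *: G (z :: take l.-1 (permseq pi s))
     (drop l.-1 (permseq pi s)) else 0.
pose E2 := if (0 < m)%N then \sum_(pi in unshuffles n l m.-1)
   koszul K pi (unzip1 s) *: ((-1) ^ (z.1 * sdeg (take l (permseq pi s))) *:
      G (take l (permseq pi s)) (z :: drop l (permseq pi s))) else 0.
transitivity (\sum_(j < n.+1) ((if j == 0 :> nat then E1 else 0)
                              + (if j == l :> nat then E2 else 0))).
  apply: eq_bigr => j _; rewrite /E1 /E2.
  have szu : size (unzip1 s) = n by rewrite size_map.
  have [j0l|] := boolP ((j == 0 :> nat) && (0 < l)%N).
    case/andP: j0l => /eqP j0; case: l lm {E1 E2} => // l lm _.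
    have {}j0 : j = ord0 by apply: val_inj.
    rewrite j0 /= addr0; apply: eq_big => [pi|pi _];
      first exact: unshuffles_lift0.
    rewrite koszul_lift permseq_lift /= !take0 /= drop0.
    by rewrite /tdeg big_nil mulr0 expr0z mul1r.
  move=> nj0; rewrite [X in X + _](_ : _ = 0) ?add0r; last first.
    by move: nj0; case: eqP => //= _ /negPf ->.
  have [jlm|njl] := boolP ((j == l :> nat) && (0 < m)%N).
    case/andP: jlm => /eqP jl; rewrite jl eqxx;
      case: m lm {E1 E2} => // m lm _ /=.
    apply: eq_big => [pi|pi _]; first exact: unshuffles_lift_mid.
    rewrite koszul_lift permseq_lift !scalerA jl.
    have szl : size (take l (permseq pi s)) = l.
      by rewrite size_takel // size_permseq -ltnS -jl.
    rewrite take_cat szl ltnn subnn take0 cats0.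
    rewrite drop_cat szl ltnn subnn drop0 mulrC; congr (_ * _ ^ (_ * _) *: _).
    by rewrite /sdeg /unzip1 map_take map_permseq.
  rewrite big_pred0 => [|pi].
    by move: njl; case: eqP => //= _ /negPf ->.
  by apply/negP => /unshuffles_liftN; rewrite (negPf nj0) (negPf njl).
rewrite big_split /= -!big_mkcond /= (big_pred1 ord0) //; congr (_ + _).
  rewrite /E1; case: l lm {E1 E2} => [|l] lm /=.
    by rewrite ssum0.
  by move: lm; rewrite addSn => -[lm];
    rewrite (IHn l m s (fun I J => G (z :: I) J)).
transitivity E2.
  rewrite /E2; case: m lm {E1 E2} => [|m] lm /=; first by rewrite big1.
  have ltl : (l < n.+1)%N by rewrite -lm addnS ltnS leq_addr.
  by rewrite (big_pred1 (Ordinal ltl)).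
rewrite /E2; case: m lm {E1 E2} => [|m] lm /=.
  (* Here l = n + 1 exceeds the size of the tail, so no subsequence I of it has size l. *)
  rewrite -[LHS](@ssum0 _ _ W s).
  apply: (@ssum_ext _ _ predT); first by rewrite all_predT.
  move=> I J _ _; rewrite sz => sIJ _; case: eqP => eI; last by rewrite scaler0.
  by move: sIJ; rewrite eI -[l]addn0 lm => /eqP;
    rewrite -[X in _ == X]addn0 addSn eqn_leq addn0 ltnNge leq_addr.
move: lm; rewrite addnS => -[lm].
rewrite (IHn l m s (fun I J => (-1) ^ (z.1 * sdeg I) *: G I (z :: J))) //.
by apply: eq_ssum => I J; case: eqP; rewrite ?scaler0.
Qed.

End Koszul.

Lemma all_permseq (V : zmodType) (Q : pred V) n (pi : 'S_n) s :
  size s = n -> all Q s -> all Q (permseq pi s).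
Proof.
move=> sz /(all_nthP 0) Qs; apply/(all_nthP 0) => i;
  rewrite size_permseq => lt_i.
by rewrite -[i]/(val (Ordinal lt_i)) nth_permseq; apply: Qs; rewrite sz.
Qed.

(** * Graded symmetry and exchanges of neighbours *)

Section Symmetry.
Variable K : fieldType.

Definition hpair (V : gspace K) (z : int * V) : bool := gcomp z.1 z.2 == z.2.

Lemma hpairs_homogs (V : gspace K) (s : seq (int * V)) :
  all (@hpair V) s -> homogs (unzip1 s) (unzip2 s).
Proof.
move=> /all_nthP hs; split; rewrite !size_map // => i lt_i.
by rewrite !(nth_map 0) //; apply/eqP/hs.
Qed.

Lemma homogs_hpairs (V : gspace K) ds (vs : seq V) : homogs ds vs ->
  exists s : seq (int * V),
    [/\ ds = unzip1 s, vs = unzip2 s & all (@hpair V) s].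
Proof.
case=> sz h; exists (zip ds vs); rewrite unzip1_zip ?unzip2_zip ?sz //;
  split=> //.
apply/(all_nthP 0) => i; rewrite size_zip sz minnn => lt_i.
by apply/eqP; rewrite nth_zip //=; apply: h.
Qed.

Lemma swap_move (V : zmodType) (W : lmodType K) (Q : pred (int * V))
    (f : seq (int * V) -> W) :
  (forall s1 x y s2, all Q s1 -> Q x -> Q y -> all Q s2 ->
     f (s1 ++ x :: y :: s2) = (-1) ^ (x.1 * y.1) *: f (s1 ++ y :: x :: s2)) ->
  forall s1 I z J, all Q s1 -> all Q I -> Q z -> all Q J ->
    f (s1 ++ I ++ z :: J) = (-1) ^ (z.1 * sdeg I) *: f (s1 ++ z :: I ++ J).
Proof.
move=> fC s1 I z J Qs1 + Qz QJ.
elim: I s1 Qs1 => [|x I IHI] s1 Qs1 /=; first by rewrite sdeg_nil mulr0 scale1r.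
case/andP=> Qx QI; rewrite -cat_rcons IHI // ?all_rcons ?Qx // cat_rcons.
rewrite fC // ?all_cat ?QI ?QJ // scalerA sdeg_cons; congr (_ *: _); sgn.
Qed.

(** Symmetry under exchanges of neighbours is enough: the head is first moved to its position, then
    the tail is permuted by induction. *)
Lemma swap_gsymmetric (V : zmodType) (W : lmodType K) (Q : pred (int * V))
    (f : seq (int * V) -> W) :
  (forall s1 x y s2, all Q s1 -> Q x -> Q y -> all Q s2 ->
     f (s1 ++ x :: y :: s2) = (-1) ^ (x.1 * y.1) *: f (s1 ++ y :: x :: s2)) ->
  forall n (pi : 'S_n) s, size s = n -> all Q s ->
    f (permseq pi s) = koszul K pi (unzip1 s) *: f s.
Proof.
move=> fC n; elim: n f fC => [|n IHn] f fC pi s.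
  case: s => // _ _; have ->: pi = 1%g by apply/permP => -[].
  by rewrite koszul1 scale1r permseq1.
case: s => //= z s [sz] /andP[Qz Qs]; have [g _ gK] := lift_perm_bij n.
rewrite -(gK pi); move: (g pi) => [j pi'] /=; rewrite koszul_lift permseq_lift.
have Qp := all_permseq pi' sz Qs.
rewrite -[_ ++ _]cat0s (swap_move fC) ?cat_take_drop //=; last first.
- by move: Qp; rewrite -{1}(cat_take_drop j (permseq pi' s)) all_cat => /andP[].
- by move: Qp; rewrite -{1}(cat_take_drop j (permseq pi' s)) all_cat => /andP[].
rewrite (IHn (fun s => f (z :: s))) //; last first.
  by move=> s1 x y s2 *; rewrite -!cat_cons fC //= Qz.
by rewrite scalerA /sdeg /unzip1 map_take map_permseq.
Qed.

Lemma gsymmetric_move (V W : gspace K) (f : seq V -> W) I z J :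
  gsymmetric f -> all (@hpair V) I -> hpair z -> all (@hpair V) J ->
  f (unzip2 (I ++ z :: J)) = (-1) ^ (z.1 * sdeg I) *: f (unzip2 (z :: I ++ J)).
Proof.
move=> f_sym hI hz hJ.
have hs : all (@hpair V) (z :: I ++ J) by rewrite /= hz all_cat hI.
have move_seq (V' : zmodType) (g : int * V -> V') n (j : 'I_n.+1) :
    size (I ++ J) = n -> j = size I :> nat ->
  permseq (lift_perm j ord0 1%g) (map g (z :: I ++ J)) = map g (I ++ z :: J).
  move=> sz ej; rewrite map_cons permseq_lift permseq1 ?size_map //.
  by rewrite !map_cat take_cat drop_cat ej size_map ltnn subnn take0 drop0
    cats0.
have szu : size (unzip2 (I ++ J)) = size (I ++ J) by rewrite size_map.
(* The permutation that places the head z at position [size I] and keeps the order of the rest. *)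
have := f_sym _ _ (hpairs_homogs hs) (lift_perm (inord (size I)) ord0 1%g).
have szI : inord (n' := size (unzip2 (I ++ J))) (size I) = size I :> nat.
  by rewrite inordK // ltnS szu size_cat leq_addr.
rewrite move_seq // => ->.
rewrite [unzip1 (z :: _)]map_cons koszul_lift koszul1 mulr1 permseq1 ?size_map
  //.
by rewrite szI /sdeg /unzip1 map_cat take_cat size_map ltnn subnn take0 cats0.
Qed.

End Symmetry.

(** * Iterated commutators *)

Section IteratedCommutators.
Variables (K : fieldType) (S : galg K) (T : gmod S).
Implicit Types (F G : T -> T) (s : seq (int * S)) (U : T).

Let hp : pred (int * S) := @hpair K S.

Lemma mactC i j (u v : S) U : @homog K S i u -> @homog K S j v ->
  mact u (mact v U) = (-1) ^ (i * j) *: mact v (mact u U).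
Proof.
move=> hu hv; rewrite -!mact_mul (ga_comm hu hv).
by rewrite (linZ (@mactl_linear _ _ T U)).
Qed.

Lemma macZ (u : S) c U : mact u (c *: U) = c *: mact u U.
Proof. exact: (linZ (@mact_linear _ _ T u)). Qed.

Lemma macD (u : S) U U' : mact u (U + U') = mact u U + mact u U'.
Proof. exact: (linD (@mact_linear _ _ T u)). Qed.

Lemma macB (u : S) U U' : mact u (U - U') = mact u U - mact u U'.
Proof. exact: (linB (@mact_linear _ _ T u)). Qed.

Lemma macDl (u v : S) U : mact (u + v) U = mact u U + mact v U.
Proof. exact: (linD (@mactl_linear _ _ T U)). Qed.

Lemma macZl c (u : S) U : mact (c *: u) U = c *: mact u U.
Proof. exact: (linZ (@mactl_linear _ _ T U)). Qed.

Lemma mac0l U : mact (0 : S) U = 0.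
Proof. exact: (lin0 (@mactl_linear _ _ T U)). Qed.

Lemma mac0 (u : S) : mact u (0 : T) = 0.
Proof. exact: (lin0 (@mact_linear _ _ T u)). Qed.

(* [iter_comm] along homogeneous elements paired with their degrees. *)
Fixpoint hcomm (p : int) F s : T -> T :=
  if s is z :: s' then hcomm (p + z.1) (gcommutator p z.1 F (mact z.2)) s'
  else F.

Lemma hcomm_cat p F s1 s2 :
  hcomm p F (s1 ++ s2) = hcomm (p + sdeg s1) (hcomm p F s1) s2.
Proof.
elim: s1 p F => [|z s1 IHs] p F /=; first by rewrite sdeg_nil addr0.
by rewrite IHs sdeg_cons addrA.
Qed.

Lemma hcomm_rcons p F s z U :
  hcomm p F (rcons s z) U
  = hcomm p F s (mact z.2 U)
    - (-1) ^ ((p + sdeg s) * z.1) *: mact z.2 (hcomm p F s U).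
Proof. by rewrite -cats1 hcomm_cat. Qed.

Lemma eq_hcomm p F G s : F =1 G -> hcomm p F s =1 hcomm p G s.
Proof.
elim: s p F G => [|z s IHs] p F G //= eFG; apply: IHs => U.
by rewrite /gcommutator !eFG.
Qed.

Lemma hcomm_comb p c F G s U :
  hcomm p (fun U => c *: F U + G U) s U = c *: hcomm p F s U + hcomm p G s U.
Proof.
elim: s p F G U => [|z s IHs] p F G U //=; rewrite -IHs; apply: eq_hcomm => {}U.
rewrite /gcommutator macD macZ !scalerDr !scalerN !scalerA opprD addrACA.
by rewrite [c * _]mulrC.
Qed.

Lemma hcomm0 p s U : hcomm p (fun _ => 0) s U = 0.
Proof.
rewrite -[RHS](addNr (hcomm p (fun _ => 0) s U)) -[X in X + _]scaleN1r.
rewrite -hcomm_comb; apply: eq_hcomm => {}U.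
by rewrite scaler0 addr0.
Qed.

Lemma hcommZ p c F s U : hcomm p (fun U => c *: F U) s U = c *: hcomm p F s U.
Proof.
rewrite -[RHS]addr0 -(hcomm0 p s U) -hcomm_comb; apply: eq_hcomm => {}U.
by rewrite addr0.
Qed.

Lemma hcomm_sum p n (F : nat -> T -> T) s U :
  hcomm p (fun U => \sum_(i < n) F i U) s U = \sum_(i < n) hcomm p (F i) s U.
Proof.
elim: n => [|n IHn].
  rewrite [RHS]big_ord0 -[RHS](hcomm0 p s U); apply: eq_hcomm => {}U.
  by rewrite big_ord0.
rewrite big_ord_recr /= addrC -IHn -[X in X + _]scale1r -hcomm_comb.
by apply: eq_hcomm => U'; rewrite big_ord_recr /= addrC scale1r.
Qed.

Lemma gcommutator_linear p q F (u : S) :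
  linear F -> linear (@gcommutator K T p q F (mact u)).
Proof.
move=> F_lin c U U'; rewrite /gcommutator macD macZ !(linD F_lin) !(linZ F_lin).
rewrite macD macZ !scalerDr scalerN !scalerA opprD addrACA.
by rewrite [c * _]mulrC.
Qed.

Lemma hcomm_linear p F s : linear F -> linear (hcomm p F s).
Proof.
by elim: s p F => //= z s IHs p F F_lin; apply: IHs; apply: gcommutator_linear.
Qed.

Lemma homogD (V : gspace K) i (u v : V) : homog i u -> homog i v -> homog i (u
  + v).
Proof. by rewrite /homog (linD (@gcomp_linear K V i)) => -> ->. Qed.

Lemma homogZ (V : gspace K) i c (v : V) : homog i v -> homog i (c *: v).
Proof. by rewrite /homog (linZ (@gcomp_linear K V i)) => ->. Qed.

Lemma homogB (V : gspace K) i (u v : V) : homog i u -> homog i v -> homog i (u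
  - v).
Proof. by rewrite /homog (linB (@gcomp_linear K V i)) => -> ->. Qed.

Lemma homog0 (V : gspace K) i : homog i (0 : V).
Proof. exact: (lin0 (@gcomp_linear K V i)). Qed.

Lemma hcomm_deg p F s : linear_of_degree p F -> all hp s ->
  linear_of_degree (p + sdeg s) (hcomm p F s).
Proof.
elim: s p F => [|z s IHs] p F; first by rewrite sdeg_nil addr0.
move=> [F_lin F_deg] /= /andP[/eqP hz hs]; rewrite sdeg_cons addrA;
  apply: IHs => //.
split=> [|i v hv]; first exact: gcommutator_linear.
apply: homogB; first by rewrite -addrA; apply/F_deg/mact_deg.
by apply: homogZ; rewrite -addrA addrCA; apply/mact_deg/F_deg.
Qed.

(** Graded Jacobi identity, where the commutator of the two multiplications vanishes because S is
    graded commutative. *)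
Lemma hcomm_swap p F s1 x y s2 U : linear F ->
  hp x -> hp y ->
  hcomm p F (s1 ++ x :: y :: s2) U
  = (-1) ^ (x.1 * y.1) *: hcomm p F (s1 ++ y :: x :: s2) U.
Proof.
move=> F_lin /eqP hx /eqP hy; rewrite !hcomm_cat -hcommZ /=.
move: (hcomm_linear p s1 F_lin);
  move: (hcomm p F s1) (p + _) => {F_lin p s1}F p.
move=> F_lin; rewrite addrAC; apply: eq_hcomm => {}U; rewrite /gcommutator.
rewrite (mactC U hx hy) (linZ F_lin) !macB !macZ.
rewrite (mactC (F U) hx hy) !scalerBr !scalerA !opprB !addrA.
rewrite -!scaleNr -!addrA; congr (_ + _); rewrite addrC -addrA addrCA.
by congr (_ + (_ + _)); congr (_ *: _); sgn.
Qed.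

(** Multiplication by v commutes with all multiplications along s, so it can be pulled out on the
    right at the cost of passing them; in [hcomm_mull] it leaves on the left and passes nothing. *)
Lemma hcomm_mulr p F (v : S) j s U : linear F -> @homog K S j v -> all hp s ->
  hcomm (p + j) (fun U => F (mact v U)) s U
  = (-1) ^ (j * sdeg s) *: hcomm p F s (mact v U).
Proof.
move=> + hv; elim: s p F U => [|z s IHs] p F U F_lin /=.
  by rewrite sdeg_nil mulr0 scale1r.
case/andP=> /eqP hz hs; rewrite sdeg_cons.
rewrite (@eq_hcomm _ _ (fun U => (-1) ^ (j * z.1)
          *: gcommutator p z.1 F (mact z.2) (mact v U))).
  rewrite hcommZ addrAC IHs //; last exact: gcommutator_linear.
  by rewrite scalerA; congr (_ *: _); sgn.
move=> {}U; rewrite /gcommutator (mactC U hv hz) (linZ F_lin) scalerBr !scalerA.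
by congr (_ - _ *: _); sgn.
Qed.

Lemma hcomm_mull p F (u : S) i s U : @homog K S i u -> all hp s ->
  hcomm (i + p) (fun U => mact u (F U)) s U = mact u (hcomm p F s U).
Proof.
move=> hu; elim: s p F U => [|z s IHs] p F U //= /andP[/eqP hz hs].
rewrite -addrA -IHs //; apply: eq_hcomm => {}U.
rewrite /gcommutator macB macZ (mactC (F U) hu hz) !scalerA.
by congr (_ - _ *: _); sgn.
Qed.

(** From [F, uv] = [F, u] v + (-)^(Fu) u [F, v]: both factors pass through the remaining
    commutators. This is the Leibniz rule that R inherits. *)
Lemma hcomm_mul p F i j (u v : S) s U : linear F ->
  @homog K S i u -> @homog K S j v -> all hp s ->
  hcomm p F ((i + j, u * v) :: s) U
  = (-1) ^ (j * sdeg s) *: hcomm p F ((i, u) :: s) (mact v U)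
    + (-1) ^ (p * i) *: mact u (hcomm p F ((j, v) :: s) U).
Proof.
move=> F_lin hu hv hs /=.
rewrite -hcomm_mulr //; last exact: gcommutator_linear.
rewrite -(hcomm_mull _ _ _ hu hs) -hcommZ [i + (p + j)]addrCA -!addrA.
rewrite -[X in _ = X + _]scale1r -hcomm_comb; apply: eq_hcomm => {}U.
rewrite /gcommutator !mact_mul scale1r macB macZ scalerBr !scalerA.
rewrite addrA subrK; congr (_ - _ *: _); sgn.
Qed.

(** A graded commutator is a derivation of composition, so each entry of s falls on F or on G. The
    explicit sign moves G past the entries falling on F; [ssum] supplies the rest. *)
Lemma hcomm_comp p q F G s U : linear F ->
  hcomm (p + q) (fun U => F (G U)) s U
  = ssum s (fun I J => (-1) ^ (q * sdeg I) *: hcomm p F I (hcomm q G J U)).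
Proof.
elim: s p q F G U => [|z s IHs] p q F G U F_lin /=.
  by rewrite sdeg_nil mulr0 scale1r.
rewrite (@eq_hcomm _ _ (fun U => (-1) ^ (q * z.1)
            *: gcommutator p z.1 F (mact z.2) (G U)
          + F (gcommutator q z.1 G (mact z.2) U))); last first.
  move=> {}U; rewrite /gcommutator (linB F_lin) (linZ F_lin) scalerBr !scalerA.
  rewrite [RHS]addrC addrA subrK; congr (_ - _ *: _); sgn.
rewrite hcomm_comb addrAC IHs; last exact: gcommutator_linear.
rewrite addrAC -addrA IHs // -ssumZ; congr (_ + _); apply: eq_ssum => I J.
  by rewrite scalerA sdeg_cons; congr (_ *: _); sgn.
by rewrite scalerA; congr (_ *: _); sgn.
Qed.

End IteratedCommutators.

Lemma gcomp_supp (K : fieldType) (V : gspace K) (v : V) :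
  exists2 r : seq int, uniq r & forall d, d \notin r -> gcomp d v = 0.
Proof.
have [r ur vE] := gcomp_sum v; exists r => // d; rewrite {}[in X in _ -> X]vE.
rewrite (lin_sum (@gcomp_linear K V d)); move=> dr;
  rewrite big_seq big1 // => i ir.
by rewrite gcompK; case: eqP dr => // ->; rewrite ir.
Qed.

(** * Iterated commutators along arbitrary elements *)

Section IterComm.
Variables (K : fieldType) (S : galg K) (T : gmod S).
Implicit Types (F G : T -> T) (U : T).

Let hp : pred (int * S) := @hpair K S.
Local Notation piece d u := (@gcomp K S d u).

Lemma gcommutator0 p d F U : linear F -> @gcommutator K T p d F (mact 0) U = 0.
Proof.
move=> F_lin; rewrite /gcommutator !(lin0 (@mactl_linear _ _ T _)) (lin0 F_lin).
by rewrite scaler0 subr0.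
Qed.

Lemma eq_iter_comm p F G us : F =1 G -> iter_comm p F us =1 iter_comm p G us.
Proof.
elim: us p F G => [|u us IHus] p F G //= eFG U; apply: eq_fsbigr => d _.
by apply: IHus => {}U; rewrite /gcommutator !eFG.
Qed.

Lemma iter_comm0 p F us U : (forall V, F V = 0) -> iter_comm p F us U = 0.
Proof.
elim: us p F => [|u us IHus] p F //= F0; apply: fsbig1 => d _.
by apply: IHus => V; rewrite /gcommutator !F0 (lin0 (@mact_linear _ _ T _))
  scaler0 subr0.
Qed.

(** Any finite set of degrees containing the support will do, so that several arguments can be
    expanded over a common one. *)
Lemma iter_comm_cons p F u us U (r : seq int) : linear F -> uniq r ->
  (forall d, d \notin r -> piece d u = 0) ->
  iter_comm p F (u :: us) U
  = \sum_(d <- r)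
      iter_comm (p + d) (gcommutator p d F (mact (piece d u : S))) us U.
Proof.
move=> F_lin ur ru /=; rewrite (fsbigE r) //=; last first.
  by move=> d _ /ru /= ->; apply: iter_comm0 => V; apply: gcommutator0.
by rewrite big_mkcond; apply: eq_bigr => d _; rewrite in_setT.
Qed.

Lemma iter_comm_comb p c F G us U : linear F -> linear G ->
  iter_comm p (fun U => c *: F U + G U) us U
  = c *: iter_comm p F us U + iter_comm p G us U.
Proof.
elim: us p F G => [|u us IHus] p F G // F_lin G_lin.
have [r ur ru] := @gcomp_supp K S u.
rewrite !(iter_comm_cons _ _ _ _ ur ru) //; last first.
  by move=> c' U' V'; rewrite !(linD F_lin) !(linD G_lin) !(linZ F_lin)
    !(linZ G_lin) !scalerDr !scalerA addrACA [c * _]mulrC.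
rewrite scaler_sumr -big_split /=; apply: eq_bigr => d _.
rewrite -IHus; [|exact: gcommutator_linear..].
apply: eq_iter_comm => V; rewrite /gcommutator macD macZ.
by rewrite !scalerDr !scalerN !scalerA opprD addrACA [c * _]mulrC.
Qed.

Lemma iter_comm_linear p F us : linear F -> linear (iter_comm p F us).
Proof.
elim: us p F => [|u us IHus] p F // F_lin c U V.
have [r ur ru] := @gcomp_supp K S u.
rewrite !(iter_comm_cons _ _ _ F_lin ur ru) scaler_sumr -big_split /=.
by apply: eq_bigr => d _; apply: IHus; apply: gcommutator_linear.
Qed.

Lemma iter_comm_multilinear p F U : linear F ->
  @multilinear K S T (fun us => iter_comm p F us U).
Proof.
move=> + s1 s2 c x y; elim: s1 p F => [|u s1 IHs] p F F_lin.
  have [rx _ xr] := @gcomp_supp K S x; have [ry _ yr] := @gcomp_supp K S y.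
  pose r := undup (rx ++ ry); have ur : uniq r by apply: undup_uniq.
  have rx0 d : d \notin r -> piece d x = 0.
    by rewrite mem_undup mem_cat negb_or => /andP[/xr].
  have ry0 d : d \notin r -> piece d y = 0.
    by rewrite mem_undup mem_cat negb_or => /andP[_ /yr].
  have rc d : d \notin r -> piece d (c *: x + y) = 0.
    by move=> dr; rewrite gcomp_linear rx0 ?ry0 // scaler0 addr0.
  rewrite /= -!/(iter_comm p F (_ :: s2) U).
  rewrite (iter_comm_cons _ _ _ F_lin ur rx0) (iter_comm_cons _ _ _ F_lin ur
    ry0).
  rewrite (iter_comm_cons _ _ _ F_lin ur rc).
  rewrite scaler_sumr -big_split /=; apply: eq_bigr => d _.
  rewrite -iter_comm_comb; [|exact: gcommutator_linear..].
  apply: eq_iter_comm => V; rewrite /gcommutator ga_linear.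
  rewrite !macDl !macZl (linD F_lin) (linZ F_lin) !scalerDr !scalerN !scalerA.
  by rewrite opprD addrACA [c * _]mulrC.
have [r ur ru] := @gcomp_supp K S u.
rewrite !cat_cons !(iter_comm_cons _ _ _ F_lin ur ru) scaler_sumr -big_split /=.
by apply: eq_bigr => d _; apply: IHs; apply: gcommutator_linear.
Qed.

Lemma iter_comm_hcomm p F (s : seq (int * S)) U : linear F -> all hp s ->
  iter_comm p F (unzip2 s) U = hcomm p F s U.
Proof.
elim: s p F => [|z s IHs] p F // F_lin /= /andP[/eqP hz hs].
rewrite -/(iter_comm p F (z.2 :: unzip2 s) U).
rewrite (@iter_comm_cons _ _ _ _ _ [:: z.1]) //; last first.
  by move=> d; rewrite inE => dz; rewrite -hz gcompK (negPf dz).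
by rewrite big_seq1 hz IHs //; apply: gcommutator_linear.
Qed.

End IterComm.

(** * Generation of the symmetric algebra *)

Section GradedSubalgebra.
Variables (K : fieldType) (S : galg K) (P : {pred S}).
Hypotheses (P_alg : GRing.subalg_closed P)
  (P_comp : forall i u, u \in P -> ga_comp i u \in P).

HB.instance Definition _ := GRing.isSubalgClosed.Build K S P P_alg.

(** A graded subalgebra as an object of its own, so that it can be a target in the universal
    property of the symmetric algebra. *)
Record gsub : Type := GSub { gsub_val :> S; gsubP : gsub_val \in P }.

HB.instance Definition _ := [isSub for gsub_val].
HB.instance Definition _ := [Choice of gsub by <:].
HB.instance Definition _ := [SubChoice_isSubAlgebra of gsub by <:].

Definition gsub_comp i (u : gsub) : gsub := GSub (P_comp i (gsubP u)).

Lemma gsub_linear i : linear (gsub_comp i).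
Proof. by move=> c u v; apply: val_inj; rewrite /= ga_linear. Qed.

Lemma gsub_compK i j u :
  gsub_comp i (gsub_comp j u) = if i == j then gsub_comp j u else 0.
Proof. by apply: val_inj; rewrite /= ga_compK; case: ifP. Qed.

Lemma gsub_sum u :
  exists2 r : seq int, uniq r & u = \sum_(i <- r) gsub_comp i u.
Proof.
have [r ur uE] := ga_sum (val u); exists r => //; apply: val_inj.
by rewrite raddf_sum; exact: uE.
Qed.

Lemma gsub_one : gsub_comp 0 1 = 1.
Proof. by apply: val_inj; rewrite /= ga_one. Qed.

Lemma gsub_mul i j u v : gsub_comp i u = u -> gsub_comp j v = v ->
  gsub_comp (i + j) (u * v) = u * v.
Proof.
move=> /(congr1 val) hu /(congr1 val) hv; apply: val_inj.
exact: (ga_mul hu hv).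
Qed.

Lemma gsub_comm i j u v : gsub_comp i u = u -> gsub_comp j v = v ->
  u * v = (-1) ^ (i * j) *: (v * u).
Proof.
move=> /(congr1 val) hu /(congr1 val) hv; apply: val_inj.
exact: (ga_comm hu hv).
Qed.

Definition gsubalg : galg K :=
  GAlg gsub_linear gsub_compK gsub_sum gsub_one gsub_mul gsub_comm.

End GradedSubalgebra.

Section Generation.
Variables (K : fieldType) (A : galg K) (L : gmod A).
Variables (S : galg K) (iA : A -> S) (iL : L -> S).

Let hpL : pred (int * L) := @hpair K L.

Section Sprod.
Hypotheses (iA_hom : is_galg_hom iA) (iL_hom : is_gmod_hom_alg iA iL).

Lemma iA_deg i (a : A) : @homog K A i a -> @homog K S i (iA a).
Proof. by case: iA_hom => _ _ _ iA_gr; rewrite /homog iA_gr => ->. Qed.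

Lemma iL_deg i (x : L) : homog i x -> @homog K S i (iL x).
Proof. by case: iL_hom => _ _ iL_gr; rewrite /homog iL_gr => ->. Qed.

Lemma sprod_cons x xs : sprod iL (x :: xs) = iL x * sprod iL xs.
Proof. exact: big_cons. Qed.

Lemma sprod_cat xs ys : sprod iL (xs ++ ys) = sprod iL xs * sprod iL ys.
Proof. exact: big_cat. Qed.

Lemma sprod_deg s : all hpL s -> @homog K S (sdeg s) (sprod iL (unzip2 s)).
Proof.
elim: s => [_|z s IHs /andP[/eqP hz hs]].
  by rewrite sdeg_nil /sprod big_nil; apply: ga_one.
by rewrite sdeg_cons sprod_cons; apply: ga_mul (IHs hs); apply: iL_deg.
Qed.

(** The index keeps all summands in one degree, so that the sign rules for homogeneous elements
    remain applicable in inductions on the span. *)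
Inductive hspan : int -> S -> Prop :=
| hspan_mono i (a : A) s : @homog K A i a -> all hpL s ->
    hspan (i + sdeg s) (iA a * sprod iL (unzip2 s))
| hspan0 i : hspan i 0
| hspan_comb i c u v : hspan i u -> hspan i v -> hspan i (c *: u + v).

Lemma hspan_homog i u : hspan i u -> @homog K S i u.
Proof.
elim=> {i u} [i a s ha hs|i|i c u v _ hu _ hv]; last 2 first.
- exact: homog0.
- by apply: homogD => //; apply: homogZ.
by apply: ga_mul; [apply: iA_deg|apply: sprod_deg].
Qed.

Lemma hspanM i j u v : hspan i u -> hspan j v -> hspan (i + j) (u * v).
Proof.
move=> hu; elim=> {j v} [j b s' hb hs'|j|j c v w _ IHv _ IHw]; last 2 first.
- by rewrite mulr0; apply: hspan0.
- by rewrite mulrDr -scalerAr; apply: hspan_comb.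
elim: hu => {i u} [i a s ha hs|i|i c u v _ IHu _ IHv]; last 2 first.
- by rewrite mul0r; apply: hspan0.
- by rewrite mulrDl -scalerAl; apply: hspan_comb.
case: (iA_hom) => _ _ iAM _.
rewrite mulrA -[_ * iA b]mulrA (ga_comm (sprod_deg hs) (iA_deg hb)).
rewrite -scalerAr -scalerAl mulrA -iAM -mulrA -sprod_cat /unzip2 -map_cat.
rewrite -[X in hspan _ X]addr0; apply: hspan_comb; last exact: hspan0.
rewrite -addrA [sdeg s + _]addrCA addrA -sdeg_cat; apply: hspan_mono.
  exact: (@ga_mul K A).
by rewrite all_cat hs.
Qed.

(** Asking the condition of each component makes the subalgebra stable under taking components. *)
Definition hspanned : {pred S} := [pred u | `[< forall i, hspan i (ga_comp i u)
  >]].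

Lemma hspannedP u : reflect (forall i, hspan i (ga_comp i u)) (u \in hspanned).
Proof. by rewrite inE; apply: asboolP. Qed.

Lemma hspan_hspanned i u : hspan i u -> u \in hspanned.
Proof.
move=> hu; apply/hspannedP => j; have := hspan_homog hu;
  rewrite /homog /= => <-.
rewrite ga_compK; case: eqP => [->|_]; last exact: hspan0.
by rewrite [ga_comp i u](hspan_homog hu).
Qed.

Lemma hspanned_alg : GRing.subalg_closed hspanned.
Proof.
have lin_closed c u v :
    u \in hspanned -> v \in hspanned -> c *: u + v \in hspanned.
  move=> /hspannedP hu /hspannedP hv; apply/hspannedP => i; rewrite ga_linear.
  exact: hspan_comb.
split=> [|c u v|u v hu hv]; last 2 first.
- exact: lin_closed.
- have h0 : 0 \in hspanned by apply: (@hspan_hspanned 0); apply: hspan0.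
  have hD (u' v' : S) : u' \in hspanned -> v' \in hspanned -> u' + v' \in
    hspanned.
    by rewrite -{2}[u']scale1r; apply: lin_closed.
  have [r _ uE] := ga_sum u; have [r' _ vE] := ga_sum v;
    rewrite uE vE mulr_suml.
  elim/big_ind: _ => // i _; rewrite mulr_sumr; elim/big_ind: _ => // j _.
  by apply: (@hspan_hspanned (i + j)); apply: hspanM; apply/hspannedP.
apply: (@hspan_hspanned (0 + @sdeg L [::])).
case: (iA_hom) => _ iA1 _ _.
have -> : (1 : S) = iA 1 * sprod iL (unzip2 ([::] : seq (int * L))).
  by rewrite iA1 /sprod big_nil mulr1.
by apply: hspan_mono => //; apply: (@ga_one K A).
Qed.

Lemma hspanned_comp i u : u \in hspanned -> ga_comp i u \in hspanned.
Proof. by move/hspannedP => /(_ i) /hspan_hspanned. Qed.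

End Sprod.

(* The elements spanned by monomials form a graded subalgebra, onto which the
   universal property retracts S. *)
Lemma gsymalg_span (symS : is_gsymalg iA iL) u i :
  @homog K S i u -> hspan i u.
Proof.
case: symS => iA_hom iL_hom univ.
have P_alg := hspanned_alg iA_hom iL_hom.
have P_comp i' u' := @hspanned_comp iA_hom iL_hom i' u'.
pose B := gsubalg P_alg P_comp.
have iA_in a : iA a \in hspanned.
  have [_ _ _ iA_gr] := iA_hom; apply/hspannedP => j.
  have ->: ga_comp j (iA a) = iA (ga_comp j a) * sprod iL (unzip2 ([::] : seq
    (int * L))).
    by rewrite [LHS]iA_gr /sprod big_nil mulr1.
  rewrite -[j in hspan j _]addr0 -(sdeg_nil L); apply: hspan_mono => //.
  by rewrite /homog /= ga_compK eqxx.
have iL_in x : iL x \in hspanned.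
  have [_ iA1 _ _] := iA_hom; have [_ _ iL_gr] := iL_hom; apply/hspannedP => j.
  have ->: ga_comp j (iL x) = iA 1 * sprod iL (unzip2 [:: (j, gcomp j x)]).
    by rewrite [LHS]iL_gr /sprod big_seq1 iA1 mul1r.
  have {1}->: j = 0 + sdeg [:: (j, gcomp j x)].
    by rewrite sdeg_cons sdeg_nil addr0 add0r.
  apply: hspan_mono; first exact: (@ga_one K A).
  by rewrite /hpL /= /hpair /= gcompK !eqxx.
pose jA a : B := GSub (iA_in a); pose jL x : B := GSub (iL_in x).
have jA_hom : is_galg_hom jA.
  case: iA_hom => h1 h2 h3 h4; split.
  - by move=> c a b; apply: val_inj; rewrite /= h1.
  - by apply: val_inj; rewrite /= h2.
  - by move=> a b; apply: val_inj; rewrite /= h3.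
  - by move=> j a; apply: val_inj; rewrite /= -h4.
have jL_hom : is_gmod_hom_alg jA jL.
  case: iL_hom => h1 h2 h3; split.
  - by move=> c a b; apply: val_inj; rewrite /= h1.
  - by move=> a b; apply: val_inj; rewrite /= h2.
  - by move=> j a; apply: val_inj; rewrite /= -h3.
have [f [[[f1 f2 f3 f4] fA fL] _]] := univ B jA jL jA_hom jL_hom.
have [g [_ gU]] := univ S iA iL iA_hom iL_hom.
(* The retraction followed by the inclusion fixes the images of A and L, so by uniqueness it is the
   identity; every element thus lies in the subalgebra. *)
have fid x : gsub_val (f x) = x.
  rewrite -[LHS]/((fun x => gsub_val (f x)) x) -(gU (fun x => gsub_val (f x))).
    by rewrite (gU id).
  split=> [|a|y]; rewrite ?fA ?fL //; split=> [c a b||a b|j a].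
  - by rewrite f1.
  - by rewrite f2.
  - by rewrite f3.
  - by have := f4 j a => /(congr1 val).
by move=> hu; have /hspannedP/(_ i) := gsubP (f u); rewrite fid [ga_comp i u]hu.
Qed.

End Generation.

(** * The operators D_k *)

Section Operators.
Variables (K : fieldType) (A : galg K) (L : gmod A).
Variables (X : seq L -> L) (sg : seq L -> A -> A) (LR : is_LRinf X sg).
Variables (Q : gmod A) (Dl : seq L -> Q -> Q) (conn : right_connection sg Dl).
Variables (S : galg K) (iA : A -> S) (iL : L -> S) (symS : is_gsymalg iA iL).
Variables (T : gmod S) (t : S -> Q -> T) (tensT : is_tensor iA t).
Variables (D : nat -> T -> T) (opD : is_Dop iL X Dl t D).

Let hpL : pred (int * L) := @hpair K L.
Let hpS : pred (int * S) := @hpair K S.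

Let iA_hom : is_galg_hom iA. Proof. by case: symS. Qed.
Let iL_hom : is_gmod_hom_alg iA iL. Proof. by case: symS. Qed.

Local Notation tp s q := (t (sprod iL (unzip2 s)) q).

Lemma act_iA i j (a : A) (u : S) q : @homog K A i a -> @homog K S j u ->
  mact (iA a) (t u q) = (-1) ^ (i * j) *: t u (mact a q).
Proof.
move=> ha hu; rewrite (tens_act tensT) (ga_comm (iA_deg iA_hom ha) hu).
by rewrite (linZ (tens_linl tensT q)) (tens_bal tensT).
Qed.

(** A monomial may carry a coefficient in A, but the tensor product over A lets it act on q instead;
    bare products of elements of L therefore suffice. *)
Lemma tens_ext (W : lmodType K) (F G : T -> W) : linear F -> linear G ->
  (forall s j q, all hpL s -> homog j q -> F (tp s q) = G (tp s q)) -> F =1 G.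
Proof.
move=> F_lin G_lin eFG.
have eFG1 s q : all hpL s -> F (tp s q) = G (tp s q).
  move=> hs; have [r _ ->] := gcomp_sum q.
  rewrite (lin_sum (tens_linr tensT _)) (lin_sum F_lin) (lin_sum G_lin).
  apply: eq_bigr => j _; apply: (eFG _ j) => //.
  by rewrite /homog gcompK eqxx.
have eFG2 i u q : hspan iA iL i u -> F (t u q) = G (t u q).
  elim=> {i u} [i a s ha hs|i|i c u v _ hu _ hv]; last 2 first.
  - by rewrite (lin0 (tens_linl tensT q)) (lin0 F_lin) (lin0 G_lin).
  - by rewrite (tens_linl tensT q) F_lin G_lin hu hv.
  rewrite -(tens_act tensT) (act_iA _ ha (sprod_deg iL_hom hs)).
  by rewrite (linZ F_lin) (linZ G_lin) eFG1.
have eFG3 u q : F (t u q) = G (t u q).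
  have [r _ ->] := @gcomp_sum K S u.
  rewrite (lin_sum (tens_linl tensT q)) (lin_sum F_lin) (lin_sum G_lin).
  apply: eq_bigr => i _; apply: (eFG2 i); apply: (gsymalg_span symS).
  by rewrite /homog gcompK eqxx.
(* Both F and G factor the same balanced map, so uniqueness identifies them. *)
have [| | |g [_ gU]] := @tens_univ _ _ _ _ _ _ _ tensT W (fun u q => F (t u q)).
- by move=> q c u v; rewrite (tens_linl tensT q) F_lin.
- by move=> u c q q'; rewrite (tens_linr tensT u) F_lin.
- by move=> u a q; rewrite (tens_bal tensT).
have gF : g = F by apply: gU.
have gG : g = G by apply: gU; split=> // u q; rewrite eFG3.
by move=> U; rewrite -gF gG.
Qed.

Lemma D_lin k : (0 < k)%N -> linear (D k).
Proof. by case/opD. Qed.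

(** In the second sum I holds the arguments of Delta_k and O the elements left outside; listing I
    first accounts for the sign [sdeg I * sdeg O]. *)
Lemma D_ssum k s q : (0 < k)%N -> all hpL s ->
  D k (tp s q)
  = ssum s (fun I J => if size I == k
      then t (iL (X (unzip2 I)) * sprod iL (unzip2 J)) q else 0)
  - ssum s (fun I O => if (size I).+1 == k
      then (-1) ^ (sdeg I * sdeg O + sdeg O) *: tp O (Dl (unzip2 I) q) else 0).
Proof.
move=> k_gt0 hs; have [_ DE] := opD k_gt0.
rewrite (DE _ _ q (hpairs_homogs hs)) /=.
have : size s = size (unzip2 s) by rewrite size_map.
move: (size (unzip2 s)) => n sz; congr (_ - _).
  case: (leqP k n) => [le_kn|lt_nk]; last first.
    rewrite big_pred0 => [|pi]; last first.
      apply/negP => /unshufflesP[lm _].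
      by move: lt_nk; rewrite -lm ltnNge leq_addr.
    rewrite -[LHS](ssum0 T s); apply: (@ssum_ext _ _ predT);
      rewrite ?all_predT //.
    move=> I J _ _ szIJ _; case: eqP => // szI.
    by move: lt_nk; rewrite -sz -szIJ szI ltnNge leq_addr.
  rewrite -(sum_unshuffles _ sz (subnKC le_kn)); apply: eq_bigr => pi _.
  by rewrite -map_permseq // -map_take -map_drop.
case: (leqP k n.+1) => [le_kn|lt_nk]; last first.
  rewrite big_pred0 => [|pi]; last first.
    apply/negP => /unshufflesP[lm _].
    move: lm; rewrite (eqP (ltnW lt_nk)) add0n => ekn.
    by move: lt_nk; rewrite -ekn prednK // ltnn.
  rewrite -[LHS](ssum0 T s); apply: (@ssum_ext _ _ predT);
    rewrite ?all_predT //.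
  move=> I J _ _ szIJ _; case: eqP => // szI.
  by move: lt_nk; rewrite -sz -szIJ -szI ltnS ltnNge leq_addr.
have lm : (n.+1 - k + k.-1)%N = n.
  by apply: succn_inj; rewrite -addnS prednK // subnK.
transitivity (ssum s (fun O I => if size O == (n.+1 - k)%N
    then (-1) ^ sdeg O *: tp O (Dl (unzip2 I) q) else 0)).
  rewrite -(sum_unshuffles _ sz lm); apply: eq_bigr => pi _.
  rewrite -!map_permseq // -!map_take -!map_drop scalerA mulrC.
  by rewrite /sdeg.
rewrite ssum_swap; apply: (@ssum_ext _ _ predT); rewrite ?all_predT //.
move=> I O _ _ szIO _.
have -> : (size O == n.+1 - k)%N = ((size I).+1 == k).
  rewrite -(eqn_add2r k) subnK // -sz -szIO -addSn addnC eqn_add2r.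
  exact: eq_sym.
case: eqP => _; last exact: scaler0.
by rewrite scalerA; congr (_ *: _); sgn.
Qed.

Let X_deg s : all hpL s -> homog (1 + sdeg s) (X (unzip2 s)).
Proof. by move=> hs; apply: (lr_Xdeg LR (hpairs_homogs hs)). Qed.

Let Dl_deg s j q : all hpL s -> homog j q ->
  homog (1 + sdeg s + j) (Dl (unzip2 s) q).
Proof. by move=> hs; case: (rc_der conn (hpairs_homogs hs)) => -[_ h] _ _;
  apply: h. Qed.

Lemma ssum_homog i s (G : _ -> _ -> T) : all hpL s ->
  (forall I J, all hpL I -> all hpL J -> sdeg I + sdeg J = sdeg s ->
     homog i (G I J)) -> homog i (ssum s G).
Proof.
move=> hs hG; rewrite /homog (ssum_linear _ _ (@gcomp_linear K T i)).
by apply: (ssum_ext hs) => I J hI hJ _ dIJ; apply: hG.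
Qed.

Lemma D_deg k : (0 < k)%N -> linear_of_degree 1 (D k).
Proof.
move=> k_gt0; split=> [|i v hv]; first exact: D_lin.
have DD s j q : all hpL s -> homog j q -> homog (1 + (sdeg s + j))
  (D k (tp s q)).
  move=> hs hq; rewrite D_ssum //; apply: homogB;
    apply: ssum_homog => // I J hI hJ dIJ.
    case: eqP => _; last exact: homog0.
    rewrite addrA -dIJ [1 + (sdeg I + _)]addrA; apply: (tens_deg tensT) => //.
    apply: ga_mul; last exact: (sprod_deg iL_hom).
    exact/(iL_deg iL_hom)/X_deg.
  case: eqP => _; last exact: homog0.
  have ->: 1 + (sdeg s + j) = sdeg J + (1 + sdeg I + j).
    by rewrite -dIJ [RHS]addrCA -!addrA.
  apply/homogZ/(tens_deg tensT); first exact: (sprod_deg iL_hom).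
  exact: Dl_deg.
(* The degree is known on monomials only; as an equality of linear maps the claim falls under
   [tens_ext]. *)
suff: (fun v => gcomp (1 + i) (D k v)) =1 (fun v => D k (gcomp i v)).
  by move/(_ v); rewrite /= hv.
apply: tens_ext => [c x y|c x y|s j q hs hq].
- by rewrite (D_lin k_gt0) gcomp_linear.
- by rewrite gcomp_linear (D_lin k_gt0).
have hv' : gcomp (sdeg s + j) (tp s q) = tp s q.
  by apply: (tens_deg tensT) => //; apply: (sprod_deg iL_hom).
rewrite -(DD s j q) // gcompK (inj_eq (addrI 1)) -{2}hv' gcompK.
by case: eqP => _; rewrite ?hv' ?DD // (lin0 (D_lin k_gt0)).
Qed.

Definition iLp (z : int * L) : int * S := (z.1, iL z.2).

Lemma sdeg_iLp ys : sdeg (map iLp ys) = sdeg ys.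
Proof. by rewrite /sdeg /unzip1 -map_comp. Qed.

Lemma unzip2_iLp ys : unzip2 (map iLp ys) = map iL (unzip2 ys).
Proof. by rewrite /unzip2 -!map_comp. Qed.

Lemma hpS_iLp ys : all hpL ys -> all hpS (map iLp ys).
Proof.
rewrite all_map; apply: sub_all => z /eqP hz.
exact/eqP/(iL_deg iL_hom).
Qed.

(* Commuting with y removes exactly the unshuffles in which y stays outside
   the operation, whence the recursion on ys. *)
Lemma hcomm_D_iL k ys s q : (0 < k)%N -> all hpL ys -> all hpL s ->
  hcomm 1 (D k) (map iLp ys) (tp s q)
  = ssum s (fun I J => if (size ys + size I)%N == k
      then t (iL (X (unzip2 (ys ++ I))) * sprod iL (unzip2 J)) q else 0)
  - ssum s (fun I O => if (size ys + size I).+1 == k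
      then (-1) ^ (sdeg I * sdeg O + (1 + sdeg ys) * sdeg O)
             *: tp O (Dl (unzip2 (ys ++ I)) q) else 0).
Proof.
move=> k_gt0 + hs; elim/last_ind: ys s hs => [|ys y IHys] s hs.
  move=> _; rewrite /= D_ssum //; congr (_ - _); apply: eq_ssum => I O.
  by case: eqP => // _; rewrite sdeg_nil; congr (_ *: _); sgn.
rewrite all_rcons => /andP[hy hys]; rewrite map_rcons hcomm_rcons sdeg_iLp.
have -> : mact (iLp y).2 (tp s q) = tp (y :: s) q.
  by rewrite (tens_act tensT) -sprod_cons.
rewrite !IHys //= ?hy // macB scalerBr.
set c := (-1) ^ ((1 + sdeg ys) * y.1).
have sum_act (G G' : _ -> _ -> T) :
    (forall I J, all hpL I -> all hpL J ->
      (-1) ^ (y.1 * sdeg I) *: G' I (y :: J) = c *: mact (iL y.2) (G I J)) ->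
    ssum s (fun I J => (-1) ^ (y.1 * sdeg I) *: G' I (y :: J))
    = c *: mact (iL y.2) (ssum s G).
  move=> eG; rewrite (ssum_linear _ _ (@mact_linear _ _ T _)) -ssumZ.
  by apply: (ssum_ext hs) => I J hI hJ _ _; apply: eG.
rewrite (sum_act (fun I J => if (size ys + size I)%N == k
      then t (iL (X (unzip2 (ys ++ I))) * sprod iL (unzip2 J)) q else 0)
   (fun I J => if (size ys + size I)%N == k
      then t (iL (X (unzip2 (ys ++ I))) * sprod iL (unzip2 J)) q else 0));
        last first.
  move=> I J hI hJ; case: eqP => _; last by rewrite mac0 !scaler0.
  rewrite (tens_act tensT) mulrA [unzip2 (y :: J)]/= sprod_cons mulrA.
  have hX : @homog K S (1 + sdeg (ys ++ I)) (iL (X (unzip2 (ys ++ I)))).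
    by apply/(iL_deg iL_hom)/X_deg; rewrite all_cat hys.
  rewrite (ga_comm hX (iL_deg iL_hom (eqP hy))) -scalerAl.
  rewrite (linZ (tens_linl tensT q)) scalerA sdeg_cat; congr (_ *: _).
  by rewrite /c; sgn.
rewrite (sum_act (fun I O => if (size ys + size I).+1 == k
      then (-1) ^ (sdeg I * sdeg O + (1 + sdeg ys) * sdeg O)
             *: tp O (Dl (unzip2 (ys ++ I)) q) else 0)
   (fun I O => if (size ys + size I).+1 == k
      then (-1) ^ (sdeg I * sdeg O + (1 + sdeg ys) * sdeg O)
             *: tp O (Dl (unzip2 (ys ++ I)) q) else 0)); last first.
  move=> I O hI hO; case: eqP => _; last by rewrite mac0 !scaler0.
  rewrite macZ (tens_act tensT) [unzip2 (y :: O)]/= sprod_cons !scalerA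
    sdeg_cons.
  by congr (_ *: _); rewrite /c; sgn.
rewrite opprD addrACA addrK; congr (_ - _); apply: eq_ssum => I O.
  by rewrite size_rcons cat_rcons addnS addSn.
rewrite size_rcons cat_rcons addnS addSn sdeg_rcons sdeg_cons.
by case: eqP => // _; congr (_ *: _); sgn.
Qed.

(* a can be moved to q, so that only the derivation rule of Dl contributes. *)
Lemma hcomm_D_iA k ys s j (a : A) q : (0 < k)%N -> all hpL ys -> all hpL s ->
  @homog K A j a ->
  hcomm 1 (D k) (rcons (map iLp ys) (j, iA a)) (tp s q)
  = (-1) ^ (j * sdeg s) *: ssum s (fun I O => if (size ys + size I).+1 == k
      then (-1) ^ (sdeg I * sdeg O + (1 + sdeg ys) * sdeg O)
             *: tp O (mact (sg (unzip2 (ys ++ I)) a) q) else 0).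
Proof.
move=> k_gt0 hys hs ha; rewrite hcomm_rcons sdeg_iLp /=.
rewrite (act_iA _ ha (sprod_deg iL_hom hs)).
have F_lin := hcomm_linear 1 (map iLp ys) (D_lin k_gt0).
rewrite (linZ F_lin) !hcomm_D_iL // macB !scalerBr opprB addrA.
rewrite !(ssum_linear _ _ (@mact_linear _ _ T _)) -!ssumZ -!ssumN -!ssumD.
apply: (ssum_ext hs) => I O hI hO szIO dIO.
have hysI : all hpL (ys ++ I) by rewrite all_cat hys.
have hX : @homog K S (1 + sdeg (ys ++ I)) (iL (X (unzip2 (ys ++ I)))).
  exact/(iL_deg iL_hom)/X_deg.
have hXO := @ga_mul K S _ _ _ _ hX (sprod_deg iL_hom hO).
rewrite -dIO.
(* In the X-terms q is a bystander: a comes back out with exactly the sign of the commutator, and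
   they cancel. *)
have -> : (-1) ^ (j * (sdeg I + sdeg O)) *:
    (if (size ys + size I)%N == k
     then t (iL (X (unzip2 (ys ++ I))) * sprod iL (unzip2 O)) (mact a q) else 0)
  = (-1) ^ ((1 + sdeg ys) * j) *: mact (iA a) (if (size ys + size I)%N == k
      then t (iL (X (unzip2 (ys ++ I))) * sprod iL (unzip2 O)) q else 0).
  case: eqP => _; last by rewrite mac0 !scaler0.
  rewrite (act_iA _ ha hXO) scalerA sdeg_cat.
  by congr (_ *: _); sgn.
rewrite -addrA addrC addrA subrK.
case: eqP => _; last by rewrite mac0 !scaler0 subr0.
have [_ _ DlA] := rc_der conn (hpairs_homogs hysI).
rewrite -/(sdeg _) in DlA.
rewrite (DlA _ _ _ ha) macZ (act_iA _ ha (sprod_deg iL_hom hO)).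
rewrite (linD (tens_linr tensT _)) (linZ (tens_linr tensT _))
  !scalerDr !scalerA sdeg_cat.
(* The symbol -sigma meets the minus sign in front of the Delta-terms, so that +sigma remains. *)
rewrite (linN (@mactl_linear _ _ Q _)) (linN (tens_linr tensT _)) scalerN.
rewrite opprD opprK addrA -[RHS]add0r; congr (_ + _); apply/eqP.
by rewrite subr_eq0; apply/eqP; congr (_ *: _); sgn.
Qed.

(** After one commutator with a, only multiplication by sigma(..|a) still acts on q, and it graded
    commutes with b. *)
Lemma hcomm_D_iA2 k i j (a b : A) s U : (0 < k)%N ->
  @homog K A i a -> @homog K A j b ->
  hcomm 1 (D k) [:: (i, iA a), (j, iA b) & s] U = 0.
Proof.
move=> k_gt0 ha hb.
rewrite -[_ :: _]/([:: (i, iA a); (j, iA b)] ++ s) hcomm_cat.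
rewrite -[RHS](@hcomm0 _ _ T (1 + sdeg [:: (i, iA a); (j, iA b)]) s U).
have D_lin' := D_lin k_gt0; apply: eq_hcomm => {}U.
have F_lin : linear (hcomm 1 (D k) [:: (i, iA a)]) by apply: hcomm_linear.
move: U; apply: tens_ext => [|c x y|{}s m q hs hq].
- exact: hcomm_linear.
- by rewrite scaler0 addr0.
rewrite -[[:: _; _]]/(rcons [:: (i, iA a)] (j, iA b)) hcomm_rcons.
rewrite -[(j, iA b).2]/(iA b) -[(j, iA b).1]/j.
rewrite (act_iA _ hb (sprod_deg iL_hom hs)) (linZ F_lin).
rewrite -[[:: _]]/(rcons (map iLp [::]) (i, iA a)) !hcomm_D_iA // macZ.
rewrite (ssum_linear _ _ (@mact_linear _ _ T _)) -!ssumZ -ssumN -ssumD.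
rewrite -[RHS](ssum0 T s); apply: (ssum_ext hs) => I O hI hO szIO dIO.
case: eqP => _; last by rewrite mac0 !scaler0 subr0.
have sga_deg : @homog K A (1 + sdeg I + i) (sg (unzip2 I) a).
  by have [[_ h] _] := lr_sgder LR (hpairs_homogs hI); apply: h.
rewrite macZ (act_iA _ hb (sprod_deg iL_hom hO)) -!mact_mul.
rewrite (ga_comm sga_deg hb) (linZ (@mactl_linear _ _ Q _))
  (linZ (tens_linr tensT _)).
rewrite sdeg_rcons !scalerA -dIO; apply/eqP; rewrite subr_eq0; apply/eqP;
  congr (_ *: _).
by rewrite sdeg_iLp !sdeg_nil; sgn.
Qed.

(** The ys fill all slots of X, so I is empty; Delta takes one argument fewer and has no room for
    them. *)
Lemma hcomm_D_allL ys U : all hpL ys -> (0 < size ys)%N ->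
  hcomm 1 (D (size ys)) (map iLp ys) U = mact (iL (X (unzip2 ys))) U.
Proof.
move=> hys sz_gt0; move: U; apply: tens_ext => [||s j q hs hq].
- exact/hcomm_linear/D_lin.
- exact: mact_linear.
rewrite hcomm_D_iL // -[RHS]subr0; congr (_ - _).
  rewrite (tens_act tensT) -{1}[ys in iL (X (unzip2 ys))]cats0.
  rewrite -[RHS](@ssum_nil _ _ T s (fun I J =>
     t (iL (X (unzip2 (ys ++ I))) * sprod iL (unzip2 J)) q)).
  by apply: eq_ssum => I J; rewrite -{2}[size ys]addn0 eqn_add2l.
rewrite -[RHS](ssum0 T s); apply: eq_ssum => I J; case: eqP => //.
by move/eqP; rewrite -addnS -{2}[size ys]addn0 eqn_add2l.
Qed.

Lemma hcomm_D_lastA ys j (a : A) U : all hpL ys -> @homog K A j a ->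
  hcomm 1 (D (size ys).+1) (rcons (map iLp ys) (j, iA a)) U
  = mact (iA (sg (unzip2 ys) a)) U.
Proof.
move=> hys ha; move: U; apply: tens_ext => [||s i q hs hq].
- exact/hcomm_linear/D_lin.
- exact: mact_linear.
have sga_deg : @homog K A (1 + sdeg ys + j) (sg (unzip2 ys) a).
  by have [[_ h] _] := lr_sgder LR (hpairs_homogs hys); apply: h.
rewrite hcomm_D_iA // (act_iA _ sga_deg (sprod_deg iL_hom hs)).
transitivity ((-1) ^ (j * sdeg s) *: ((-1) ^ ((1 + sdeg ys) * sdeg s)
    *: tp s (mact (sg (unzip2 ys) a) q))); last first.
  by rewrite scalerA; congr (_ *: _); sgn.
congr (_ *: _).
transitivity (ssum s (fun I O => if size I == 0%N then
    (-1) ^ (sdeg I * sdeg O + (1 + sdeg ys) * sdeg O)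
             *: tp O (mact (sg (unzip2 (ys ++ I)) a) q) else 0)).
  by apply: eq_ssum => I O; rewrite eqSS -{2}[size ys]addn0 eqn_add2l.
by rewrite ssum_nil cats0 sdeg_nil mul0r add0r.
Qed.

(** * Full commutators as multiplication by brackets *)

Variables (Lam : seq S -> S) (brL : is_bracket iA iL X sg Lam).

Let homogs_hpS s : all hpS s -> @homogs K S (unzip1 s) (unzip2 s).
Proof. exact: (@hpairs_homogs K S). Qed.

Inductive generators : seq (int * S) -> Prop :=
| gen_nil : generators [::]
| gen_A i (a : A) gs : @homog K A i a -> generators gs ->
    generators ((i, iA a) :: gs)
| gen_L y gs : hpL y -> generators gs -> generators (iLp y :: gs).

Lemma generators_hp gs : generators gs -> all hpS gs.
Proof.
elim=> {gs} [//|i a gs ha _ hgs|y gs hy _ hgs] /=; rewrite hgs andbT.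
  exact/eqP/iA_deg.
exact/eqP/(iL_deg iL_hom)/eqP.
Qed.

Lemma generators_cat gs gs' :
  generators gs -> generators gs' -> generators (gs ++ gs').
Proof. by move=> hgs hgs'; elim: hgs => //= *; constructor. Qed.

(** No, one, or at least two entries from A: the cases of [br_X], [br_sg] and [br_AA]. *)
Lemma generatorsP gs : generators gs ->
  [\/ exists2 ys, all hpL ys & gs = map iLp ys,
      exists ys i a ys', [/\ all hpL ys, all hpL ys', @homog K A i a
        & gs = map iLp ys ++ (i, iA a) :: map iLp ys']
    | exists g1 i a g2 j b g3, [/\ @homog K A i a, @homog K A j b
        & gs = g1 ++ (i, iA a) :: g2 ++ (j, iA b) :: g3]].
Proof.
elim=> {gs} [|i a gs ha hgs|y gs hy _]; first by constructor 1; exists [::].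
  case=> [[ys hys ->]|[ys [j [b [ys' [hys hys' hb ->]]]]]|].
  - by constructor 2; exists [::], i, a, ys.
  - by constructor 3; exists [::], i, a, (map iLp ys), j, b, (map iLp ys').
  - move=> [g1 [k [c [g2 [j [b [g3 [hc hb ->]]]]]]]].
    by constructor 3; exists ((i, iA a) :: g1), k, c, g2, j, b, g3.
case=> [[ys hys ->]|[ys [j [b [ys' [hys hys' hb ->]]]]]|].
- by constructor 1; exists (y :: ys); rewrite //= hy.
- by constructor 2; exists (y :: ys), j, b, ys'; rewrite /= hy.
- move=> [g1 [k [c [g2 [j [b [g3 [hc hb ->]]]]]]]].
  by constructor 3; exists (iLp y :: g1), k, c, g2, j, b, g3.
Qed.

Lemma move_last (f : seq (int * S) -> T) :
  (forall I z J, all hpS I -> hpS z -> all hpS J ->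
     f (I ++ z :: J) = (-1) ^ (z.1 * sdeg I) *: f (z :: I ++ J)) ->
  forall I z J, all hpS I -> hpS z -> all hpS J ->
  f (I ++ z :: J) = (-1) ^ (z.1 * sdeg J) *: f (rcons (I ++ J) z).
Proof.
move=> f_move I z J hI hz hJ.
rewrite -cats1 !f_move ?all_cat ?hI ?cats0 // scalerA sdeg_cat.
by congr (_ *: _); sgn.
Qed.

Lemma hcomm_move p (F : T -> T) U I z J : linear F -> all hpS I -> hpS z -> all
  hpS J ->
  hcomm p F (I ++ z :: J) U = (-1) ^ (z.1 * sdeg I) *: hcomm p F (z :: I ++ J)
    U.
Proof.
move=> F_lin hI hz hJ.
rewrite -[I ++ _]cat0s -[z :: _]cat0s.
apply: (@swap_move _ _ _ hpS (fun s => hcomm p F s U)) => // s1 x y s2 *.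
exact: hcomm_swap.
Qed.

Definition bracketed gs :=
  forall U, hcomm 1 (D (size gs)) gs U = mact (Lam (unzip2 gs)) U.

(** A single entry from A is moved to the last slot, where [br_sg] applies, with the same sign on
    both sides. Two of them are moved to the front of the commutator, which vanishes like the
    bracket. *)
Lemma bracketed_gen gs : generators gs -> (0 < size gs)%N -> bracketed gs.
Proof.
move=> /[dup] /generators_hp hgs /generatorsP; case.
- case=> ys hys -> {gs hgs}; rewrite size_map => sz U.
  by rewrite size_map hcomm_D_allL // unzip2_iLp (br_X brL) ?size_map.
- case=> ys [i [a [ys' [hys hys' ha ->]]]] sz U.
  have hA : hpS (i, iA a) by apply/eqP; apply: iA_deg.
  have -> : size (map iLp ys ++ (i, iA a) :: map iLp ys')
    = (size (ys ++ ys')).+1.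
    by rewrite size_cat /= addnS !size_map size_cat.
  have Dn_lin := D_lin (ltn0Sn (size (ys ++ ys'))).
  rewrite (@move_last (fun s => hcomm 1 (D (size (ys ++ ys')).+1) s U))
    ?hpS_iLp //; last first.
    by move=> I z J; apply: hcomm_move.
  rewrite (@move_last (fun s => mact (Lam (unzip2 s)) U)) ?hpS_iLp //;
    last first.
    move=> I z J hI hz hJ; rewrite (gsymmetric_move (br_sym brL) hI hz hJ).
    by rewrite macZl.
  congr (_ *: _); rewrite -map_cat hcomm_D_lastA ?all_cat ?hys //.
  by rewrite [unzip2 (rcons _ _)]map_rcons -/(unzip2 _) unzip2_iLp (br_sg brL).
- case=> g1 [i [a [g2 [j [b [g3 [ha hb egs]]]]]]] sz U; move: hgs.
  rewrite {1 3 4}egs all_cat /= all_cat /= => /and5P[h1 hA h2 hB h3].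
  have h23 : all hpS (g2 ++ (j, iA b) :: g3) by rewrite all_cat /= h2 hB.
  have h12 : all hpS ((i, iA a) :: g1 ++ g2) by rewrite /= hA all_cat h1.
  rewrite (hcomm_move _ _ (D_lin sz) h1 hA h23) catA -cat_cons.
  rewrite (hcomm_move _ _ (D_lin sz) h12 hB h3).
  rewrite cat_cons hcomm_D_iA2 // !scaler0 /unzip2 !map_cat /= map_cat /=
    (br_AA brL).
  by rewrite mac0l.
Qed.

Lemma bracketed_span s1 s2 i u : all hpS s1 -> all hpS s2 ->
  (forall z, generators [:: z] -> bracketed (s1 ++ z :: s2)) ->
  hspan iA iL i u -> bracketed (s1 ++ (i, u) :: s2).
Proof.
move=> h1 h2 Hgen.
have sz z : size (s1 ++ z :: s2) = (size s1 + size s2).+1 by rewrite size_cat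
  addnS.
have F_lin := hcomm_linear 1 s1 (D_lin (ltn0Sn (size s1 + size s2))).
(* Here [hcomm_mul] and [br_der] are the same Leibniz rule: the commutators along s1 give the
   operator degree [1 + sdeg s1]. *)
have HM k l v w : @homog K S k v -> @homog K S l w ->
    bracketed (s1 ++ (k, v) :: s2) -> bracketed (s1 ++ (l, w) :: s2) ->
    bracketed (s1 ++ (k + l, v * w) :: s2).
  move=> hv hw Hv Hw U; rewrite sz hcomm_cat hcomm_mul // -!hcomm_cat.
  have := Hv (mact w U); rewrite sz => ->; have := Hw U; rewrite sz => ->.
  rewrite /unzip2 !map_cat /= (br_der brL (homogs_hpS h1) (homogs_hpS h2)
    hv hw).
  by rewrite macDl !macZl !mact_mul.
elim=> {i u} [i a s ha|i|i c u v _ Hu _ Hv]; last 2 first.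
- move=> U; rewrite sz hcomm_cat /=.
  rewrite (@eq_hcomm _ _ _ _ _ (fun _ => 0)); last by move=> V;
    apply: gcommutator0.
  rewrite hcomm0 /unzip2 map_cat /= (lin0 (br_lin brL _ _)) mac0l //.
- move=> U; have := Hv U; have := Hu U; rewrite !sz !hcomm_cat /= => eu ev.
  rewrite /unzip2 map_cat /= (br_lin brL) macDl macZl.
  rewrite /unzip2 !map_cat /= in eu ev; rewrite -eu -ev -hcomm_comb.
  apply: eq_hcomm => {eu ev}U; rewrite /gcommutator macDl macZl.
  rewrite (linD F_lin) (linZ F_lin) macDl macZl !scalerDr scalerN !scalerA.
  by rewrite opprD addrACA [c * _]mulrC.
move=> hs; apply: (HM); [exact: iA_deg|exact: (sprod_deg iL_hom)| |].
  by apply: Hgen; apply: gen_A ha gen_nil.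
elim: s hs => [_|y s IHs /= /andP[hy hs]].
  (* The empty product is the image of 1 in A, hence itself a generator. *)
  rewrite sdeg_nil /sprod big_nil; case: (iA_hom) => _ <- _ _.
  by apply: Hgen; apply: gen_A (@ga_one K A) gen_nil.
rewrite sdeg_cons sprod_cons; apply: HM;
  [exact/(iL_deg iL_hom)/eqP|exact: (sprod_deg iL_hom)| |].
  by apply: (Hgen (iLp y)); apply: gen_L hy gen_nil.
exact: IHs.
Qed.

Lemma bracketed_all gs : all hpS gs -> (0 < size gs)%N -> bracketed gs.
Proof.
(* Arguments are freed one slot at a time: for the head of s2 it is enough to treat generators, and
   these lengthen the prefix s1. *)
suff H s2 s1 : generators s1 -> all hpS s2 -> (0 < size (s1 ++ s2))%N ->
    bracketed (s1 ++ s2).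
  by move=> hgs sz; apply: (H gs [::]) => //; constructor.
elim: s2 s1 => [|[i u] s2 IHs] s1 h1.
  by rewrite cats0 => _; apply: bracketed_gen.
case/andP=> hu h2 _; apply: bracketed_span => //; first exact: generators_hp.
  move=> z hz; rewrite -cat_rcons; apply: IHs => //.
    by rewrite -cats1; apply: generators_cat.
  by rewrite size_cat size_rcons.
exact/(gsymalg_span symS)/eqP.
Qed.

End Operators.

(** * Connection and curvature *)

Lemma big_ord_pick (V : zmodType) n k (x : V) :
  \sum_(i < n) (if i == k :> nat then x else 0) = if (k < n)%N then x else 0.
Proof.
case: ifP => [lt_kn|/negbT]; last first.
  rewrite -leqNgt => le_nk; rewrite big1 // => i _; case: eqP => // eik.
  by have := ltn_ord i; rewrite eik ltnNge le_nk.
rewrite (bigD1 (Ordinal lt_kn)) //= eqxx big1 ?addr0 // => i.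
by rewrite -val_eqE /= => /negPf ->.
Qed.

Section HigherDerivedBrackets.
Variables (K : fieldType) (S : galg K) (T : gmod S).
Variables (D : nat -> T -> T) (Lam : seq S -> S).

Let hp : pred (int * S) := @hpair K S.

(** These facts alone make R a connection with the stated curvature: the setting of higher derived
    brackets. *)
Hypothesis D_deg : forall k, (0 < k)%N -> linear_of_degree 1 (D k).
Hypotheses (Lam0 : Lam [::] = 0) (Lam_deg : @degree1 K S S Lam).
Hypothesis D_Lam : forall s U, all hp s -> (0 < size s)%N ->
  hcomm 1 (D (size s)) s U = mact (Lam (unzip2 s)) U.

Let D_lin k : (0 < k)%N -> linear (D k).
Proof. by case/D_deg. Qed.

Let Lam_hp s : all hp s -> hp (1 + sdeg s, Lam (unzip2 s)).
Proof. by move=> hs; apply/eqP; apply/Lam_deg/(@hpairs_homogs K S). Qed.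

Lemma Rop_hcomm s U : all hp s ->
  Rop D (unzip2 s) U = hcomm 1 (D (size s).+1) s U.
Proof.
move=> hs; rewrite /Rop size_map.
by apply: iter_comm_hcomm => //; apply: D_lin.
Qed.

(** The first k commutators leave a multiplication, which the next one kills. *)
Lemma hcomm_D_vanish k s U : (0 < k)%N -> (k < size s)%N -> all hp s ->
  hcomm 1 (D k) s U = 0.
Proof.
move=> k_gt0 lt_k hs; rewrite -(cat_take_drop k s) hcomm_cat.
have: all hp (take k s ++ drop k s) by rewrite cat_take_drop.
have szt : size (take k s) = k by rewrite size_takel // ltnW.
rewrite all_cat => /andP[ht].
have := size_drop k s; case: (drop k s) => [|z s' _].
  by move/eqP; rewrite eq_sym subn_eq0 leqNgt lt_k.
case/andP=> /eqP hz _ /=.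
rewrite -[RHS](@hcomm0 _ _ T (1 + sdeg (take k s) + z.1) s' U).
have DL V : hcomm 1 (D k) (take k s) V = mact (Lam (unzip2 (take k s))) V.
  by have := @D_Lam (take k s) V ht; rewrite szt; apply.
by apply: eq_hcomm => {}U; rewrite /gcommutator !DL (mactC U (eqP (Lam_hp ht))
  hz) subrr.
Qed.

Lemma Rop_multilinear U : @multilinear K S T (fun us => Rop D us U).
Proof.
move=> s1 s2 c x y; rewrite /Rop !size_cat /=.
by apply: iter_comm_multilinear; apply: D_lin.
Qed.

Lemma Rop_linear us : linear (Rop D us).
Proof. by move=> c U V; apply: iter_comm_linear; apply: D_lin. Qed.

Lemma Rop_connection :
  @right_connection K (base K) (over_base S) (over_base T)
    (fun _ _ => 0) (Rop D).
Proof.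
split=> [U s1 s2 c x y|U ds us /homogs_hpairs[s [-> -> hs]] pi|ds us|].
- exact: Rop_multilinear.
- have : size s = size (unzip2 s) by rewrite size_map.
  move: (size (unzip2 s)) pi => n pi sz.
  rewrite -map_permseq // !Rop_hcomm ?all_permseq // size_permseq sz.
  apply: (swap_gsymmetric (Q := hp) (f := fun s => hcomm 1 _ s U)) =>
    // s1 x y s2 *.
  by apply: hcomm_swap => //; apply: D_lin.
- move/homogs_hpairs => [s [-> -> hs]]; split.
  + have := hcomm_deg (D_deg (ltn0Sn (size s))) hs.
    case=> h1 h2; split=> [c x y|i v hv]; rewrite !Rop_hcomm //;
      first exact: h1.
    exact: h2.
  + split=> [|i a b _]; last by rewrite oppr0 mul0r mulr0 scaler0 addr0.
    split=> [c a b|i a _]; first by rewrite oppr0 scaler0 addr0.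
    by rewrite oppr0; apply: homog0.
  + move=> i a U ha; rewrite !Rop_hcomm //.
    have F_lin := hcomm_linear 1 s (D_lin (ltn0Sn (size s))).
    rewrite /= /base_act oppr0 scale0r addr0 (linZ F_lin) scalerA.
    (* A nonzero scalar is homogeneous of degree 0 only, so the signs disappear. *)
    have [->|/(base_homog ha)->] := eqVneq i 0; last by rewrite mulr0 scale0r.
    by rewrite mulr0 expr0z mul1r.
- move=> ds1 s1 j x ds2 s2 i a U h1 hx h2 ha; rewrite /= /base_act.
  rewrite (linZ (Rop_multilinear U s1 s2)) (linZ (Rop_linear _)) !scalerA.
  have [->|/(base_homog ha)->] := eqVneq i 0; last by rewrite mulr0 !scale0r.
  by rewrite !mul0r expr0z !mul1r.
Qed.

(** The operators are odd, so their commutators are sums of both composites; reversing the index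
    shows that each occurs twice. *)
Lemma JopE n U : 2%:R != 0 :> K ->
  Jop D n.+1 U = \sum_(i < n.+1) D i.+1 (D (n - i).+1 U).
Proof.
move=> two_neq0; rewrite /Jop big_add1 /= big_mkord.
set s := RHS.
rewrite (eq_bigr (fun i : 'I_n.+1 => D i.+1 (D (n - i).+1 U)
  + D (n - i).+1 (D i.+1 U))).
  rewrite big_split /= -/s (reindex_inj rev_ord_inj) /= [X in _ + X](_ : _ = s).
    by rewrite -mulr2n -scaler_nat scalerA mulVf // scale1r.
  by apply: eq_bigr => i _; rewrite subSS subKn // -ltnS.
by move=> i _; rewrite /gcommutator expr1z scaleN1r opprK subSS subSn // -ltnS.
Qed.

Lemma curvature_Rop s U : 2%:R != 0 :> K -> all hp s ->
  @curvature K S T 1 Lam (Rop D) (unzip1 s) (unzip2 s) U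
  = iter_comm 2 (Jop D (size s).+1) (unzip2 s) U.
Proof.
move=> two_neq0 hs; rewrite /curvature.
have Jop_lin : linear (Jop D (size s).+1).
  move=> c x y; rewrite !JopE // scaler_sumr -big_split /=;
    apply: eq_bigr => i _.
  by rewrite (D_lin (ltn0Sn _)) (D_lin (ltn0Sn _)).
rewrite (iter_comm_hcomm _ _ Jop_lin hs) (eq_hcomm _ _ (fun V =>
  JopE _ V two_neq0)).
rewrite (hcomm_sum _ _ (fun i V => D i.+1 (D (size s - i).+1 V))).
pose G (I J : seq (int * S)) : T := Rop D (Lam (unzip2 I) :: unzip2 J) U
  + (-1) ^ sdeg I *: Rop D (unzip2 I) (Rop D (unzip2 J) U).
transitivity (ssum s G).
  have : size s = size (unzip2 s) by rewrite size_map.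
  move: (size (unzip2 s)) => n sz.
  (* The index i is the size of I, so the double sum is one sum over all decompositions. *)
  transitivity (ssum s (fun I J => \sum_(i < n.+1)
    if i == size I :> nat then G I J else 0)).
    rewrite -(ssum_sum _ _ (fun i I J => if i == size I :> nat then G I J else
      0)).
    apply: eq_bigr => i _.
    have le_in : (i <= n)%N by rewrite -ltnS.
    transitivity (ssum s (fun I J => if size I == i :> nat then G I J else 0)).
      rewrite -(sum_unshuffles _ sz (subnKC le_in)); apply: eq_bigr => pi _.
      by rewrite -!map_permseq // -!map_take -!map_drop /G mul1r.
    by apply: eq_ssum => I J; rewrite eq_sym.
  apply: (ssum_ext (P := predT)); first by rewrite all_predT.
  by move=> I J _ _ szIJ _; rewrite big_ord_pick ltnS -sz -szIJ leq_addr.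
(* Only i = size I, i.+1 = size I and i = (size I).+1 contribute, by
   [hcomm_D_vanish]; these are their terms. *)
pose t1 (I J : seq (int * S)) : T := (-1) ^ sdeg I *: hcomm 1 (D (size I).+1)
  I (hcomm 1 (D (size J).+1) J U).
pose t2 (I J : seq (int * S)) : T := (-1) ^ sdeg I *: mact (Lam (unzip2 I))
  (hcomm 1 (D (size J).+2) J U).
pose t3 (I J : seq (int * S)) : T := (-1) ^ sdeg I *: hcomm 1 (D (size I).+2)
  I (mact (Lam (unzip2 J)) U).
transitivity (ssum s (fun I J => t1 I J + t2 I J + t3 I J)).
  rewrite !ssumD [ssum s t3]ssum_swap -!ssumD;
    apply: (ssum_ext hs) => I J hI hJ _ _.
  have F_lin := D_lin (ltn0Sn (size J).+1).
  rewrite /G !Rop_hcomm // [LHS]addrC -addrA; congr (_ + _).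
  have hz : hp (1 + sdeg I, Lam (unzip2 I)) by exact: Lam_hp.
  rewrite (@Rop_hcomm ((1 + sdeg I, Lam (unzip2 I)) :: J)) ?[all _ _]/= ?hz //.
  (* With the bracket in the last slot its commutator is outermost, and the two terms of this
     commutator are [t2] and the swapped [t3]. *)
  have := @hcomm_move _ _ _ 1 (D (size J).+2) U J _ [::] F_lin hJ hz isT.
  rewrite cats0 cats1 => eq_mv.
  have {eq_mv} -> : hcomm 1 (D (size J).+2) ((1 + sdeg I, Lam (unzip2 I)) :: J)
    U
    = (-1) ^ ((1 + sdeg I) * sdeg J)
      *: hcomm 1 (D (size J).+2) (rcons J (1 + sdeg I, Lam (unzip2 I))) U.
    by rewrite eq_mv scalerA -[LHS]scale1r; congr (_ *: _) => /=; sgn.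
  rewrite hcomm_rcons scalerBr [LHS]addrC /t2 /t3 /= -scaleNr !scalerA.
  by congr (_ *: _ + _ *: _); sgn.
have D_comp (i : 'I_(size s).+1) :
  hcomm 2 (fun V => D i.+1 (D (size s - i).+1 V)) s U
  = ssum s (fun I J => (-1) ^ sdeg I *: hcomm 1 (D i.+1)
    I (hcomm 1 (D (size s - i).+1) J U)).
  rewrite (@hcomm_comp _ _ T 1 1 (D i.+1) (D (size s - i).+1));
    last exact: D_lin.
  by apply: eq_ssum => I J; rewrite mul1r.
rewrite (eq_bigr _ (fun i _ => D_comp i)).
rewrite (ssum_sum _ _ (fun i I J => (-1) ^ sdeg I *: hcomm 1 (D i.+1)
  I (hcomm 1 (D (size s - i).+1) J U))).
apply: (ssum_ext hs) => I J hI hJ <- _.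
transitivity (\sum_(i < (size I + size J).+1)
   ((if i == size I :> nat then t1 I J else 0)
    + (if i.+1 == size I :> nat then t2 I J else 0)
    + (if i == (size I).+1 :> nat then t3 I J else 0))).
  rewrite !big_split /= !big_ord_pick ltnS leq_addr.
  (* For empty I no index qualifies, in agreement with [t2] being 0 because [Lam [::]] is; likewise
     for [t3] and empty J. *)
  have -> : \sum_(i < (size I + size J).+1) (if i.+1 == size I then t2 I J else
    0)
      = t2 I J.
    case: (I) => [|z I'] /=.
      by rewrite big1 // /t2 Lam0 mac0l scaler0.
    by rewrite (big_ord_pick _ (size I')) addSn ltnS leqW // leq_addr.
  congr (_ + _); rewrite ltnS -addn1 leq_add2l; case: ifP => // /negbT.
  by rewrite -eqn0Ngt => /nilP ->;
    rewrite /t3 Lam0 mac0l (lin0 (hcomm_linear _ _ (D_lin _))) ?scaler0.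
apply: eq_bigr => -[i /= lt_i] _.
have [->|neI] := eqVneq i (size I).
  by rewrite addKn (gtn_eqF (ltnSn _)) (ltn_eqF (ltnSn _)) !addr0.
rewrite add0r; have [eI|neI1] := eqVneq i.+1 (size I).
  rewrite -eI (ltn_eqF (leqW (ltnSn i))) addr0 addSn -addnS addKn.
  by rewrite eI D_Lam // -eI.
rewrite add0r; have [ei|neI2] := eqVneq i (size I).+1.
  have J_gt0 : (0 < size J)%N.
    by rewrite lt0n; apply: contraTneq lt_i => ->; rewrite ei addn0 ltnn.
  have eJ : (size I + size J - i).+1 = size J.
    by rewrite ei -[(size I).+1]addn1 subnDl subn1 prednK.
  by rewrite eJ D_Lam // ei.
(* In the remaining cases either I is longer than the order of its operator, or J is. *)
case: (ltngtP i (size I)) => [lt_iI|lt_Ii|eiI]; last by rewrite eiI eqxx in neI.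
  by rewrite hcomm_D_vanish ?scaler0 // ltn_neqAle neI1.
rewrite (@hcomm_D_vanish _ J) ?(lin0 (hcomm_linear _ _ (D_lin _))) ?scaler0 //.
have lt_I1i : ((size I).+1 < i)%N by rewrite ltn_neqAle eq_sym neI2.
have J_gt0 : (0 < size J)%N.
  by rewrite lt0n; apply: contraTneq lt_i => ->; rewrite addn0 ltnS -ltnNge.
rewrite -ltn_predRL ltn_subLR; last by rewrite -ltnS.
by rewrite -{1}(prednK J_gt0) addnS -addSn ltn_add2r.
Qed.

End HigherDerivedBrackets.

Theorem theorem49 (K : fieldType) (charK : [pchar K] =i pred0)
  (A : galg K) (L : gmod A) (X : seq L -> L) (sg : seq L -> A -> A)
  (LR : is_LRinf X sg)
  (Q : gmod A) (Dl : seq L -> Q -> Q) (conn : right_connection sg Dl)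
  (S : galg K) (iA : A -> S) (iL : L -> S) (symS : is_gsymalg iA iL)
  (T : gmod S) (t : S -> Q -> T) (tensT : is_tensor iA t)
  (D : nat -> T -> T) (opD : is_Dop iL X Dl t D)
  (Lam : seq S -> S) (brL : is_bracket iA iL X sg Lam) :
  [/\ @right_connection K (base K) (over_base S) (over_base T)
        (fun _ _ => 0) (Rop D),
      (forall ds (us : seq S) (U : T), @homogs K S ds us ->
         @curvature K S T 1 Lam (Rop D) ds us U
         = iter_comm 2 (Jop D (size us).+1) us U),
      (forall ds (us : seq S) i (u : S) (U : T),
         @homogs K S ds us -> @homog K S i u ->
         Rop D us (mact u U)
         = mact (Lam (rcons us u)) U
           + (-1) ^ (i * (tdeg ds + 1)) *: mact u (Rop D us U))
    & (forall ds (us : seq S) i (u : S) j (u1 : S) (U : T),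
         @homogs K S ds us -> @homog K S i u -> @homog K S j u1 ->
         Rop D (u * u1 :: us) U
         = (-1) ^ i *: mact u (Rop D (u1 :: us) U)
           + (-1) ^ (j * tdeg ds) *: Rop D (u :: us) (mact u1 U))].
Proof.
have D_degree := D_deg LR conn symS tensT opD.
have D_linear k (k_gt0 : (0 < k)%N) : linear (D k) by case: (D_degree k k_gt0).
have D_Lam s U : all (@hpair K S) s -> (0 < size s)%N ->
    hcomm 1 (D (size s)) s U = mact (Lam (unzip2 s)) U.
  by move=> hs sz; apply: (bracketed_all LR conn symS tensT opD brL hs sz U).
have two_neq0 : 2%:R != 0 :> K by have := charK 2; rewrite !inE /= => ->.
split.
- exact: Rop_connection.
- move=> ds us U /homogs_hpairs[s [-> -> hs]]; rewrite size_map.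
  exact: (curvature_Rop D_degree (br_0 brL) (br_deg brL) D_Lam U two_neq0 hs).
- move=> ds us i u U /homogs_hpairs[s [-> -> hs]] hu; rewrite !Rop_hcomm //.
  (* With u appended the commutator is full, hence multiplication by the bracket; expanding its last
     step is the claimed formula. *)
  have hsu : all (@hpair K S) (rcons s (i, u)) by rewrite all_rcons hs andbT;
    apply/eqP.
  have := D_Lam _ U hsu; rewrite size_rcons => /(_ isT).
  rewrite hcomm_rcons /unzip2 map_rcons /= => <-.
  by rewrite -/(sdeg s) [i * _]mulrC [sdeg s + 1]addrC subrK.
- move=> ds us i u j u1 U /homogs_hpairs[s [-> -> hs]] hu hu1.
  have Rop_cons d v V : @homog K S d v ->
      Rop D (v :: unzip2 s) V = hcomm 1 (D (size s).+2) ((d, v) :: s) V.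
    by move=> hv; rewrite -(@Rop_hcomm _ _ _ _ _ ((d, v) :: s)) //= hs andbT;
      apply/eqP.
  rewrite (Rop_cons _ _ _ (ga_mul hu hu1)) (Rop_cons _ _ _ hu)
    (Rop_cons _ _ _ hu1).
  by rewrite hcomm_mul //; [rewrite mul1r addrC|exact: D_linear].
Qed.
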